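(* Let $G$ be a planar graph with $p=|V(G)|$ vertices, maximum degree $\Delta$, and $L=L(G)$. Let $\mathcal{E}:=\bigcup_{m\geq 2}\mathcal{T}_m\cup\bigcup_{m\geq 3}\mathcal{Q}_m\cup\{S_5,S_7\}$. (i) If $G\notin\mathcal{E}$, then for every integer $n\geq 3$: $A_n(G)=\{0,1,2\}$ if $n\leq L$; $A_n(G)=\{0,1\}$ if $L<n\leq\Delta$; $A_n(G)=\{0\}$ if $\Delta<n\leq p$; and $A_n(G)=\emptyset$ if $n>p$. (ii) If $G\in\mathcal{T}_m$ with $m\geq 3$, then $A_3(G)=\{1,2\}$; $A_n(G)=\{0,1,2\}$ for $4\leq n\leq m$; $A_{m+1}(G)=\{0,1\}$; $A_{m+2}(G)=\{0\}$; and $A_n(G)=\emptyset$ for $n>m+2$. (iii) If $G\in\mathcal{Q}_m$ with $m\geq 3$, then $A_n(G)=\{0,1,2\}$ for $3\leq n\leq m-1$; $A_n(G)=\{0,2\}$ for $m\leq n\leq\Delta$; $A_n(G)=\{0\}$ for $\Delta<n\leq p$; and $A_n(G)=\emptyset$ for $n>p$. (iv) $A_3(K_4)=\{1\}$, $A_4(K_4)=\{0\}$, and $A_n(K_4)=\emptyset$ for $n\geq 5$. (v) $A_3(S_5)=\{1,2\}$, $A_4(S_5)=\{0,1,2\}$, $A_5(S_5)=A_6(S_5)=\{0,1\}$, $A_7(S_5)=\{0\}$, and $A_n(S_5)=\emptyset$ for $n\geq 8$. (vi) $A_3(S_7)=\{1,2\}$, $A_4(S_7)=\{0,1,2\}$,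 $A_5(S_7)=A_6(S_7)=\{0,1\}$, $A_7(S_7)=A_8(S_7)=\{0\}$, and $A_n(S_7)=\emptyset$ for $n\geq 9$.
   Context: All graphs are simple and finite. For distinct vertices $u_1,\dots,u_n$ of $G$, $N(u_1,\dots,u_n)$ is the set of vertices of $G$ adjacent to all of $u_1,\dots,u_n$, and \[A_n(G):=\{a : \exists \text{ distinct } u_1,\dots,u_n\in V(G) \text{ with } |N(u_1,\dots,u_n)|=a\}.\] $L(G):=\max\{\ell\in\mathbb{N} : G \text{ contains } K_{2,\ell} \text{ as a subgraph}\}$, with $L(G)=0$ if there is no $\ell\ge1$ with this property. $P_m$ is the simple path on $m\ge 2$ vertices; $G_1+G_2$ denotes the join (disjoint union of $G_1$ and $G_2$ together with all edges between $V(G_1)$ and $V(G_2)$). $\mathcal{T}_m:=\{H+K_2 : H \text{ is a spanning subgraph of } P_m \text{ with no isolated vertices}\}$, $m\geq 2$ (graphs are considered up to isomorphism; $\mathcal{T}_2=\{K_4\}$). For $m\geq 3$, $\mathcal{Q}_m$ is the class of planar graphs $G$ with $\Delta(G)\geq m$ for which $m$ is the minimum integer ($\geq 3$) such that for every vertex $v$ of degree at least $m$ there exists another vertex $w\ne v$ with $N(w)=N(v)$. $S_5$ is the graph obtained from $K_4$ with vertices $a,b,c,d$ by adding three new vertices, adjacent respectively to exactly $\{a,b,c\}$, $\{a,b,d\}$, $\{a,c,d\}$. $S_7$ is obtained from $K_4$ with vertices $a,b,c,d$ by adding four new vertices, adjacent respectively to exactly $\{a,b,c\}$, $\{a,b,d\}$,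 $\{a,c,d\}$, $\{b,c,d\}$. *)

(* Defs.v *)
(* MathComp, with MathComp-Analysis for drawings in the plane. *)
From HB Require Import structures.
From mathcomp Require Import all_boot all_order all_algebra.
From mathcomp Require Import all_classical all_reals all_analysis.
Set Implicit Arguments.
Unset Strict Implicit.
Unset Printing Implicit Defensive.
Import Order.TTheory GRing.Theory Num.Theory.
Import numFieldNormedType.Exports.

Local Open Scope classical_set_scope.
Local Open Scope nat_scope.

Record sgraph := SGraph {
  vertex :> finType;
  adj : rel vertex;
  adj_sym : symmetric adj;
  adj_irr : irreflexive adj }.

Definition isomorphic (G H : sgraph) : Prop :=
  exists f : G -> H, bijective f /\ forall x y, adj (f x) (f y) = adj x y.

Definition is_subgraph (H G : sgraph) : bool :=
  [exists f : {ffun H -> G}, injectiveb f &&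
     [forall x, forall y, adj x y ==> adj (f x) (f y)]].

(* Up to isomorphism: [H] is identified with a graph on the vertices of [G]. *)
Definition is_spanning_subgraph (H G : sgraph) : Prop :=
  exists f : H -> G, bijective f /\ forall x y, adj x y -> adj (f x) (f y).

Definition no_isolated_vertex (G : sgraph) : Prop :=
  forall x : G, exists y : G, adj x y.

(** Concrete graphs *)

Definition complete_rel (n : nat) : rel 'I_n := fun x y => x != y.

Lemma complete_sym n : symmetric (@complete_rel n).
Proof. by move=> x y; rewrite /complete_rel eq_sym. Qed.

Lemma complete_irr n : irreflexive (@complete_rel n).
Proof. by move=> x; rewrite /complete_rel eqxx. Qed.

Definition complete (n : nat) : sgraph :=
  SGraph (@complete_sym n) (@complete_irr n).

Definition bipartite_rel (m n : nat) : rel ('I_m + 'I_n)%type :=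
  fun x y => match x, y with
             | inl _, inr _ | inr _, inl _ => true
             | _, _ => false
             end.

Lemma bipartite_sym m n : symmetric (@bipartite_rel m n).
Proof. by case=> x [] y. Qed.

Lemma bipartite_irr m n : irreflexive (@bipartite_rel m n).
Proof. by case. Qed.

Definition complete_bipartite (m n : nat) : sgraph :=
  SGraph (@bipartite_sym m n) (@bipartite_irr m n).

Definition path_rel (m : nat) : rel 'I_m :=
  fun x y => (x.+1 == y :> nat) || (y.+1 == x :> nat).

Lemma path_rel_sym m : symmetric (@path_rel m).
Proof. by move=> x y; rewrite /path_rel orbC. Qed.

Lemma path_rel_irr m : irreflexive (@path_rel m).
Proof. by move=> x; rewrite /path_rel orbb gtn_eqF. Qed.

Definition path_graph (m : nat) : sgraph :=
  SGraph (@path_rel_sym m) (@path_rel_irr m).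

Definition join_rel (G1 G2 : sgraph) : rel (G1 + G2)%type :=
  fun x y => match x, y with
             | inl a, inl b => adj a b
             | inr a, inr b => adj a b
             | _, _ => true
             end.

Lemma join_sym G1 G2 : symmetric (@join_rel G1 G2).
Proof. by case=> x [] y //=; rewrite adj_sym. Qed.

Lemma join_irr G1 G2 : irreflexive (@join_rel G1 G2).
Proof. by case=> x /=; rewrite adj_irr. Qed.

Definition join (G1 G2 : sgraph) : sgraph :=
  SGraph (@join_sym G1 G2) (@join_irr G1 G2).

(* [K4plus s] is K_4 together with [size s] new vertices, the i-th of them
   being adjacent to exactly the vertices of K_4 listed in the i-th entry. *)
Definition K4plus_rel (s : seq (seq nat)) : rel ('I_4 + 'I_(size s))%type :=
  fun x y => match x, y with
             | inl a, inl b => a != b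
             | inl a, inr i | inr i, inl a => nat_of_ord a \in nth [::] s i
             | inr _, inr _ => false
             end.

Lemma K4plus_sym s : symmetric (@K4plus_rel s).
Proof. by case=> x [] y //=; rewrite eq_sym. Qed.

Lemma K4plus_irr s : irreflexive (@K4plus_rel s).
Proof. by case=> x //=; rewrite eqxx. Qed.

Definition K4plus (s : seq (seq nat)) : sgraph :=
  SGraph (@K4plus_sym s) (@K4plus_irr s).

Definition S5 : sgraph := K4plus [:: [:: 0; 1; 2]; [:: 0; 1; 3]; [:: 0; 2; 3]].

Definition S7 : sgraph :=
  K4plus [:: [:: 0; 1; 2]; [:: 0; 1; 3]; [:: 0; 2; 3]; [:: 1; 2; 3]].

(** Parameters *)

Definition common_nbrs (G : sgraph) (s : seq G) : {set G} :=
  [set v | all (fun u => adj u v) s]%SET.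

Definition nbrs (G : sgraph) (v : G) : {set G} := common_nbrs [:: v].

Definition max_degree (G : sgraph) : nat := \max_(v : G) #|nbrs v|.

Definition A (n : nat) (G : sgraph) : set nat :=
  [set a | exists2 u : n.-tuple G, uniq u & #|common_nbrs u| = a].

(* Only l < #|G| matters, since K_{2,l} has l + 2 vertices; the maximum of the
   empty family is 0. *)
Definition L (G : sgraph) : nat :=
  \max_(l < #|G| | is_subgraph (complete_bipartite 2 l) G) l.

(** Planarity *)

Definition arc_between (R : realType) (a b : R * R) (X : set (R * R)) : Prop :=
  exists c : R -> R * R,
    [/\ {within `[0%R, 1%R], continuous c},
        {in `[0%R, 1%R] &, injective c},
        c 0%R = a, c 1%R = b & X = c @` `[0%R, 1%R]].

(* [arc x y] is only relevant when x and y are adjacent. *)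
Definition plane_drawing (R : realType) (G : sgraph)
    (pt : G -> R * R) (arc : G -> G -> set (R * R)) : Prop :=
  [/\ injective pt,
      forall x y, adj x y ->
        arc_between (pt x) (pt y) (arc x y) /\ arc x y = arc y x,
      forall x y z, adj x y -> arc x y (pt z) -> z = x \/ z = y
    & forall x y u v, adj x y -> adj u v ->
        [set x; y]%SET != [set u; v]%SET ->
        arc x y `&` arc u v `<=` range pt].

Definition planar (R : realType) (G : sgraph) : Prop :=
  exists (pt : G -> R * R) (arc : G -> G -> set (R * R)),
    plane_drawing pt arc.

(** The exceptional classes *)

Definition class_T (m : nat) (G : sgraph) : Prop :=
  exists H : sgraph,
    [/\ is_spanning_subgraph H (path_graph m), no_isolated_vertex H
      & isomorphic G (join H (complete 2))].

Definition twin_from (m : nat) (G : sgraph) : Prop :=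
  forall v : G, m <= #|nbrs v| -> exists2 w : G, w != v & nbrs w = nbrs v.

Definition class_Q (R : realType) (m : nat) (G : sgraph) : Prop :=
  [/\ planar R G, m <= max_degree G, 3 <= m, twin_from m G
    & forall k, 3 <= k -> twin_from k G -> m <= k].

Definition exceptional (R : realType) (G : sgraph) : Prop :=
  [\/ exists2 m, 2 <= m & class_T m G,
      exists2 m, 3 <= m & class_Q R m G,
      isomorphic G S5
    | isomorphic G S7].

(* Main.v *)
(** The topological input is the non-planarity of K_5 and K_{3,3}, obtained
    without the Jordan curve theorem. The arcs of disjoint edges are at a
    positive distance, so they can be replaced by polygonal lines in general
    position that still do not meet. Modulo 2, two closed polygons without common
    vertices cross evenly; hence the parity of the number of crossings between
    disjoint edges of a polygonal drawing of K_5 is that of the straight-line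
    drawing, which is odd, and K_{3,3} reduces to K_5. Since edges may be replaced
    by walks, minors are excluded as well.

    As K_{3,3} is excluded, A_n is contained in {0, 1, 2} for n >= 3, and 2 is in
    A_n exactly when n <= L. If 1 is not in A_n, every n neighbours of a vertex
    have a second common neighbour, which is shown to depend on the vertex only
    and to be a twin of it, so that G is in some Q_m with m <= n. If 0 is not in
    A_3, any two neighbours of a vertex x of maximum degree have a common
    neighbour in N(x). Either N(x) contains a vertex adjacent to all others, and G
    is in some T_m, or N(x) induces a triangle with a vertex stacked on each side,
    and G is S_5 or S_7. *)

Require Import Defs.
From HB Require Import structures.
From mathcomp Require Import all_boot all_order all_algebra.
From mathcomp Require Import all_classical all_reals all_analysis.
From mathcomp Require Import ring lra zify.
From Stdlib Require Import Btauto.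
Set Implicit Arguments.
Unset Strict Implicit.
Unset Printing Implicit Defensive.
Local Open Scope classical_set_scope.
Local Open Scope nat_scope.

(** Only disjoint edges have separated arcs; arcs with a common end touch, so their approximations
    may cross at will. All counts are therefore restricted to disjoint pairs, and for the same
    reason walks replacing edges at a common vertex may overlap: this is what admits contracted
    paths as branch sets. Vertices of polygons are labels in an abstract type, so that disjointness
    is a matter of labels, and general position makes all orientations strict signs. In the
    combinatorial part most minors contract a path that serves as a third route between two
    vertices. The absence of 1 from A_n is harder for n = 3: exchanging one of n >= 4 neighbours
    keeps three of them, enough for K_{3,3} to pin down the second common neighbour, whereas n = 3
    keeps only two. The absence of 0 matters for n = 3 alone, since a set without common neighbour
    can be enlarged. Maximality of the degree of x keeps a vertex adjacent to the rest of N(x) from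
    having neighbours elsewhere, which excludes vertices not adjacent to x. *)

(** * Crossings of polygonal lines modulo 2 *)

Definition det3 (R : realType) (a b c : R * R) : R :=
  ((b.1 - a.1) * (c.2 - a.2) - (b.2 - a.2) * (c.1 - a.1))%R.

Section Chains.
Variable T : eqType.
Implicit Types (f : T -> T -> bool) (x y : T) (p q : seq T).

Fixpoint walk_sum f x p : bool :=
  if p is y :: p' then f x y (+) walk_sum f y p' else false.

Lemma walk_sum_cat f x p q :
  walk_sum f x (p ++ q) = walk_sum f x p (+) walk_sum f (last x p) q.
Proof. by elim: p x => [|y p IH] x //=; rewrite IH addbA. Qed.

Lemma walk_sum_rev f x p :
  (forall a b, a \in x :: p -> b \in x :: p -> f a b = f b a) ->
  walk_sum f (last x p) (rev (belast x p)) = walk_sum f x p.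
Proof.
elim: p x => [|y p IH] x //= fC.
rewrite rev_cons -cats1 walk_sum_cat IH => [|a b ha hb]; last first.
  by apply: fC; rewrite inE (ha, hb) orbT.
rewrite /= addbF addbC (fC x) ?inE ?eqxx ?orbT //; congr (f _ _ (+) _).
by case: p {IH fC} => [|z p] //=; rewrite rev_cons last_rcons.
Qed.

Lemma eq_walk_sum f f' x p : (forall a b, a \in x :: p -> b \in x :: p ->
    f a b = f' a b) -> walk_sum f x p = walk_sum f' x p.
Proof.
elim: p x => [|y p IH] x //= H; rewrite H ?inE ?eqxx ?orbT //; congr addb.
by apply: IH => a b ha hb; apply: H; rewrite inE (ha, hb) orbT.
Qed.

Lemma walk_sum_cobound f g x p :
  (forall a b, a \in x :: p -> b \in x :: p -> f a b = g a (+) g b) ->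
  walk_sum f x p = g x (+) g (last x p).
Proof.
move=> H; rewrite (eq_walk_sum H) {H}.
by elim: p x => [|y p IH] x /=; rewrite ?addbb // IH addbA addbK.
Qed.

Lemma walk_sum_addb f f' x p :
  walk_sum (fun a b => f a b (+) f' a b) x p =
  walk_sum f x p (+) walk_sum f' x p.
Proof. by elim: p x => [|y p IH] x //=; rewrite IH addbACA. Qed.

Lemma walk_sum_path (e : rel T) f x p :
  (forall a b, e a b -> f a b = false) -> path e x p -> walk_sum f x p = false.
Proof. by move=> H; elim: p x => [|y p IH] x //= /andP[/H-> /IH->]. Qed.

End Chains.

Section Crossings.
Import Order.TTheory GRing.Theory Num.Theory.
Variables (R : realType) (T : eqType) (q : T -> R * R).
Hypothesis gen : forall a b c, a != b -> a != c -> b != c ->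
  det3 (q a) (q b) (q c) != 0%R.

Definition ccw a b c : bool := (0 < det3 (q a) (q b) (q c))%R.

(** Meaningful only for segments without a common end: for distinct points [cross a b a d] is false,
    whereas [cross b a a d] equals [ccw b a d]. Hence the distinctness conditions on every reversal
    of a segment. *)
Definition cross a b c d : bool :=
  (ccw a b c (+) ccw a b d) && (ccw c d a (+) ccw c d b).

Lemma det3C (a b c : R * R) : det3 b a c = (- det3 a b c)%R.
Proof. rewrite /det3; ring. Qed.

Lemma det3_rot (a b c : R * R) : det3 b c a = det3 a b c.
Proof. rewrite /det3; ring. Qed.

Lemma ccw_rot a b c : ccw b c a = ccw a b c.
Proof. by rewrite /ccw det3_rot. Qed.

Lemma ccwC a b c : a != b -> a != c -> b != c -> ccw b a c = ~~ ccw a b c.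
Proof.
move=> ab ac bc; rewrite /ccw det3C oppr_gt0 -leNgt le_eqVlt.
by rewrite (negPf (gen ab ac bc)).
Qed.

Lemma ccw_degen a b : (ccw a a b = false) * (ccw a b a = false) *
  (ccw b a a = false).
Proof.
have E u v : ccw u u v = false.
  by rewrite /ccw (_ : det3 _ _ _ = 0%R) ?ltxx // /det3; ring.
by rewrite -(ccw_rot a b a) -(ccw_rot b a a) !E.
Qed.

Lemma crossC a b c d : cross a b c d = cross c d a b.
Proof. by rewrite /cross andbC. Qed.

Lemma cross_refl a c d : cross a a c d = false.
Proof. by rewrite /cross !ccw_degen. Qed.

Lemma cross_swap a b c d : a != c -> a != d -> b != c -> b != d ->
  cross b a c d = cross a b c d.
Proof.
case: (eqVneq a b) => [->//|ab] ac ad bc bd.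
rewrite /cross (@ccwC a b c) // (@ccwC a b d) // addbN addNb negbK.
by rewrite (addbC (ccw c d b)).
Qed.

(* The four determinants of a quadruple satisfy one linear relation, so their
   signs cannot alternate. *)
Lemma ccw_quad a b c d : a != b -> a != c -> a != d -> b != c -> b != d ->
  c != d -> ~~ [&& ccw a b c == ccw a c d, ccw a b c == ~~ ccw a b d &
                   ccw a b c == ~~ ccw b c d].
Proof.
move=> ab ac ad bc bd cd.
have := gen ab ac bc; have := gen ac ad cd.
have := gen ab ad bd; have := gen bc bd cd.
have : (det3 (q b) (q c) (q d) - det3 (q a) (q c) (q d) +
        det3 (q a) (q b) (q d) - det3 (q a) (q b) (q c) = 0)%R.
  by rewrite /det3; ring.
rewrite /ccw; move: (det3 _ _ _) (det3 _ _ _) (det3 _ _ _) (det3 _ _ _).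
move=> x y z t E nx ny nz nt; apply/negP.
case/and3P => /eqP h1 /eqP h2 /eqP h3; move: h1 h2 h3.
case: (ltrgt0P x) nx => // hx _; case: (ltrgt0P y) ny => // hy _;
case: (ltrgt0P z) nz => // hz _; case: (ltrgt0P t) nt => // ht _ //= _ _ _; lra.
Qed.

Lemma ccw_sort a b c : a != b -> a != c -> b != c ->
  (ccw a c b = ~~ ccw a b c) * (ccw b a c = ~~ ccw a b c) *
  (ccw b c a = ccw a b c) * (ccw c a b = ccw a b c) *
  (ccw c b a = ~~ ccw a b c).
Proof.
move=> ab ac bc; have E := ccwC ab ac bc.
by rewrite (ccw_rot a c b) (ccw_rot b a c) (ccw_rot b c a) (ccw_rot a b c) E.
Qed.

(* The right-hand side says that the four points are in convex position. *)
Lemma cross_quad a b c d : a != b -> a != c -> a != d -> b != c -> b != d ->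
  c != d -> cross a b c d (+) cross a c b d (+) cross a d b c =
  ~~ (ccw a b c (+) ccw a b d (+) ccw a c d (+) ccw b c d).
Proof.
move=> ab ac ad bc bd cd; have := ccw_quad ab ac ad bc bd cd.
have Eabc := ccw_sort ab ac bc; have Eabd := ccw_sort ab ad bd.
have Eacd := ccw_sort ac ad cd; have Ebcd := ccw_sort bc bd cd.
rewrite /cross !Eabc !Eabd !Eacd !Ebcd.
by do 4![case: (ccw _ _ _)].
Qed.

Definition in_triangle a b t c :=
  (ccw a b c == ccw b t c) && (ccw a b c == ccw t a c).

(* The signs are constrained by the Grassmann-Pluecker relation with pivot [c]. *)
Lemma ccw_pluecker a b t c d :
  a != b -> a != t -> b != t -> c != a -> c != b -> c != t ->
  d != a -> d != b -> d != t -> c != d ->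
  ~~ ((ccw b t c (+) ccw c d a == ccw t a c (+) ccw c d b) &&
      (ccw b t c (+) ccw c d a == ccw a b c (+) ccw c d t)).
Proof.
move=> ab at' bt ca cb ct da db dt cd; apply/negP.
have n1 : det3 (q a) (q b) (q c) != 0%R by apply: gen; rewrite // eq_sym.
have n2 : det3 (q b) (q t) (q c) != 0%R by apply: gen; rewrite // eq_sym.
have n3 : det3 (q t) (q a) (q c) != 0%R by apply: gen; rewrite // eq_sym.
have n4 : det3 (q c) (q d) (q a) != 0%R by apply: gen.
have n5 : det3 (q c) (q d) (q b) != 0%R by apply: gen.
have n6 : det3 (q c) (q d) (q t) != 0%R by apply: gen.
have : (det3 (q b) (q t) (q c) * det3 (q c) (q d) (q a) +
        det3 (q t) (q a) (q c) * det3 (q c) (q d) (q b) +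
        det3 (q a) (q b) (q c) * det3 (q c) (q d) (q t) = 0)%R.
  by rewrite /det3; ring.
rewrite /ccw; move: n1 n2 n3 n4 n5 n6.
move: (det3 (q a) _ _) (det3 (q b) _ _) (det3 (q t) _ _) => x y z.
move: (det3 _ _ (q a)) (det3 _ _ (q b)) (det3 _ _ (q t)) => u v w.
have S : forall r s : R, r != 0%R -> s != 0%R ->
    (0 < r * s)%R = ~~ ((0 < r)%R (+) (0 < s)%R).
  move=> r s r0 s0; case: (ltrgt0P r) r0 => // hr _; last first.
    by rewrite nmulr_rgt0 //; case: ltrgt0P s0.
  by rewrite pmulr_rgt0 //; case: (0 < s)%R.
move=> nx ny nz nu nv nw.
have := S _ _ ny nu; have := S _ _ nz nv; have := S _ _ nx nw.
have := mulf_neq0 ny nu; have := mulf_neq0 nz nv; have := mulf_neq0 nx nw.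
move: (y * u)%R (z * v)%R (x * w)%R => i j k nk nj ni Sk Sj Si E.
move/andP => [/eqP h1 /eqP h2].
move: ((0 < y)%R (+) _) ((0 < z)%R (+) _) ((0 < x)%R (+) _) h1 h2 Si Sj Sk.
move=> [] _ _ <- <-.
  by case: (ltrgt0P i) ni; case: (ltrgt0P j) nj; case: (ltrgt0P k) nk => //;
    move=> ? _ ? _ ? _; lra.
by case: (ltrgt0P i) ni; case: (ltrgt0P j) nj; case: (ltrgt0P k) nk => //;
    move=> ? _ ? _ ? _; lra.
Qed.

(** Nine orientation signs occur. The Grassmann-Pluecker relations with pivots [c] and [d] exclude
    every assignment of signs that violates the parity, so that a case check suffices. *)
Lemma cross_triangle a b t c d : a != c -> a != d -> b != c -> b != d ->
  t != c -> t != d -> a != b -> a != t -> b != t ->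
  cross a b c d (+) cross b t c d (+) cross t a c d =
  in_triangle a b t c (+) in_triangle a b t d.
Proof.
move=> ac ad bc bd tc td ab at' bt.
case: (eqVneq c d) => [->|cd].
  have E x y : cross x y d d = false by rewrite crossC cross_refl.
  by rewrite !E /= addbb.
have := @ccw_pluecker a b t c d ab at' bt; rewrite !(eq_sym c) !(eq_sym d).
move=> /(_ ac bc tc ad bd td cd).
have := @ccw_pluecker a b t d c ab at' bt; rewrite !(eq_sym c) !(eq_sym d).
move=> /(_ ad bd td ac bc tc cd).
have E x : x != c -> x != d -> ccw d c x = ~~ ccw c d x.
  by move=> xc xd; rewrite ccwC // eq_sym.
rewrite (E a) // (E b) // (E t) // /cross /in_triangle.
by do 9![case: (ccw _ _ _)].
Qed.

(* [walk_cross x p y p'] counts, modulo 2, the crossings of the polygonal lines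
   with vertices [x :: p] and [y :: p']. *)
Definition walk_cross x p y p' : bool :=
  walk_sum (fun a b => walk_sum (cross a b) y p') x p.

Lemma walk_crossC x p y p' : walk_cross x p y p' = walk_cross y p' x p.
Proof.
rewrite /walk_cross; elim: p x => [|z p IH] x /=.
  by elim: p' y => [|z p' IH] y //=; rewrite -IH.
rewrite IH -walk_sum_addb; apply: eq_walk_sum => a b _ _ /=.
by rewrite crossC.
Qed.

Lemma walk_cross_catl x p1 p2 y p' : walk_cross x (p1 ++ p2) y p' =
  walk_cross x p1 y p' (+) walk_cross (last x p1) p2 y p'.
Proof. exact: walk_sum_cat. Qed.

Lemma walk_cross_catr x p y p1 p2 : walk_cross x p y (p1 ++ p2) =
  walk_cross x p y p1 (+) walk_cross x p (last y p1) p2.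
Proof. by rewrite walk_crossC walk_cross_catl !(walk_crossC _ _ x). Qed.

Lemma walk_cross_rev x p y p' :
  (forall a b, a \in x :: p -> b \in y :: p' -> a != b) ->
  walk_cross (last x p) (rev (belast x p)) y p' = walk_cross x p y p'.
Proof.
move=> dis; apply: walk_sum_rev => a b ha hb; apply: eq_walk_sum => c d hc hd.
by apply: cross_swap; apply: dis.
Qed.

Lemma walk_cross_swap x p c d : (forall a, a \in x :: p -> a != c) ->
  (forall a, a \in x :: p -> a != d) ->
  walk_cross x p d [:: c] = walk_cross x p c [:: d].
Proof.
move=> xc xd; rewrite walk_crossC [RHS]walk_crossC.
apply: (@walk_cross_rev c [:: d]) => a b + hb.
by rewrite !inE => /orP[] /eqP->; rewrite eq_sym ?xc ?xd.
Qed.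

(* Coning the first polygon from one of its vertices splits it into triangles,
   and the second one, being closed, enters a triangle as often as it leaves. *)
Lemma walk_cross_closed x p y p' : last x p = x -> last y p' = y ->
  (forall a b, a \in x :: p -> b \in y :: p' -> a != b) ->
  walk_cross x p y p' = false.
Proof.
move=> px py dis; pose psi a b := walk_sum (cross a b) y p'.
have psiC a b : a \in x :: p -> b \in x :: p -> psi b a = psi a b.
  move=> ha hb; apply: eq_walk_sum => c d hc hd.
  by apply: cross_swap; apply: dis.
have psi0 a : psi a a = false.
  rewrite /psi (@walk_sum_cobound _ _ (fun _ => false)) // => c d _ _.
  by rewrite cross_refl.
have xx : x \in x :: p by rewrite inE eqxx.
rewrite /walk_cross (@walk_sum_cobound _ _ (psi x)) ?px ?addbb // => a b ha hb.
rewrite -/(psi a b); case: (eqVneq a x) => [->|ax]; first by rewrite psi0.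
case: (eqVneq b x) => [->|bx]; first by rewrite psi0 addbF psiC.
case: (eqVneq a b) => [->|ab]; first by rewrite psi0 addbb.
have : psi a b (+) psi b x (+) psi x a = false.
  rewrite -!walk_sum_addb (@walk_sum_cobound _ _ (in_triangle a b x)) ?py ?addbb //.
  by move=> c d hc hd; apply: cross_triangle; rewrite // dis.
rewrite (psiC x b) //.
by case: (psi a b) (psi x a) (psi x b) => [] [] [].
Qed.

(** Both lines are closed by the segment joining their ends. The crossing number of the two closed
    polygons is even, and it expands bilinearly into these four terms. *)
Lemma walk_cross_close x p y p' :
  (forall a b, a \in x :: p -> b \in y :: p' -> a != b) ->
  walk_cross x p y p' = walk_cross x p y [:: last y p'] (+)
    walk_cross x [:: last x p] y p' (+) cross x (last x p) y (last y p').
Proof.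
move=> dis.
have lx : last x p \in x :: p by rewrite mem_last.
have ly : last y p' \in y :: p' by rewrite mem_last.
have xx : x \in x :: p by rewrite inE eqxx.
have yy : y \in y :: p' by rewrite inE eqxx.
have := @walk_cross_closed x (p ++ [:: x]) y (p' ++ [:: y]).
rewrite !last_cat /= => /(_ erefl erefl) H.
have {H} : walk_cross x (p ++ [:: x]) y (p' ++ [:: y]) = false.
  apply: H => a b; rewrite -!cat_cons !mem_cat !mem_seq1 => ha hb.
  apply: dis; first by case/orP: ha => // /eqP->.
  by case/orP: hb => // /eqP->.
rewrite walk_cross_catl !walk_cross_catr.
have dl a : a \in x :: p -> a != y by move=> ha; apply: dis.
have dr a : a \in x :: p -> a != last y p' by move=> ha; apply: dis.
rewrite (@walk_cross_swap x p y) // (@walk_cross_swap (last x p) [:: x] y) //.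
- rewrite (walk_crossC (last x p)) (@walk_cross_swap y p' x) //.
  + rewrite (walk_crossC (last x p)) (@walk_cross_swap y [:: _] x) //.
    * rewrite !(walk_crossC y) {4}/walk_cross /= !addbF.
      by case: walk_cross (walk_cross _ _ _ _) (walk_cross _ _ _ _)
        (cross _ _ _ _) => [] [] [] [].
    * by move=> a; rewrite !inE => /orP[] /eqP->; rewrite eq_sym dis.
    * by move=> a; rewrite !inE => /orP[] /eqP->; rewrite eq_sym dis.
  + by move=> a ha; rewrite eq_sym dis.
  + by move=> a ha; rewrite eq_sym dis.
- by move=> a; rewrite !inE => /orP[] /eqP->; rewrite dis.
- by move=> a; rewrite !inE => /orP[] /eqP->; rewrite dis.
Qed.

End Crossings.

(** The fifteen pairs of disjoint edges of K_5; each row belongs to one omitted vertex, from 4 down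
    to 0. *)
Definition K5_sum (F : nat -> nat -> nat -> nat -> bool) : bool :=
  (F 0 1 2 3 (+) F 0 2 1 3 (+) F 0 3 1 2) (+)
  (F 0 1 2 4 (+) F 0 2 1 4 (+) F 0 4 1 2) (+)
  (F 0 1 3 4 (+) F 0 3 1 4 (+) F 0 4 1 3) (+)
  (F 0 2 3 4 (+) F 0 3 2 4 (+) F 0 4 2 3) (+)
  (F 1 2 3 4 (+) F 1 3 2 4 (+) F 1 4 2 3).

Section K5.
Import Order.TTheory GRing.Theory Num.Theory.
Variables (R : realType) (T : eqType) (q : T -> R * R).
Hypothesis gen : forall a b c, a != b -> a != c -> b != c ->
  det3 (q a) (q b) (q c) != 0%R.
Variables (v : nat -> T) (p : nat -> nat -> seq T).
Hypothesis v_inj : forall i j, i < j < 5 -> v i != v j.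
Hypothesis p_last : forall i j, i < j < 5 -> last (v i) (p i j) = v j.
Hypothesis p_disj : forall i j k l, i < j < 5 -> k < l < 5 ->
  i != k -> i != l -> j != k -> j != l ->
  forall a b, a \in v i :: p i j -> b \in v k :: p k l -> a != b.

Lemma addb_xorb b c : b (+) c = xorb b c.
Proof. by case: b c => [] []. Qed.

(* Every orientation occurs in two of the five quadruples, so an even number of
   quadruples is not in convex position. *)
Lemma K5_straight_odd : K5_sum (fun i j k l => cross q (v i) (v j) (v k) (v l)).
Proof.
rewrite /K5_sum !(cross_quad gen) ?v_inj //.
do !move: (ccw _ _ _ _).
by do 9![case] => [] [].
Qed.

(* Closing an edge by the segment joining its ends shows that straightening the
   edge does not change the parity of its crossings with the triangle spanned by
   the three other vertices. *)
Lemma K5_odd : K5_sum (fun i j k l => walk_cross q (v i) (p i j) (v k) (p k l)).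
Proof.
pose s i j k l := cross q (v i) (v j) (v k) (v l).
pose w i j k l := walk_cross q (v i) (p i j) (v k) [:: v l].
have mem_end i j : i < j < 5 -> v j \in v i :: p i j.
  by move=> ij; rewrite -(p_last ij) mem_last.
have split i j k l : i < j < 5 -> k < l < 5 -> i != k -> i != l -> j != k ->
    j != l -> walk_cross q (v i) (p i j) (v k) (p k l) =
    w i j k l (+) w k l i j (+) s i j k l.
  move=> ij kl ik il jk jl; rewrite walk_cross_close ?p_last //.
    by rewrite (walk_crossC _ _ [:: v j]).
  exact: p_disj.
have v_neq i j k l : i < j < 5 -> k < l < 5 -> i != k -> i != l -> j != k ->
    j != l -> {in [:: v k; v l], forall b a, a \in v i :: p i j -> a != b}.
  move=> ij kl ik il jk jl b; rewrite !inE => /orP[] /eqP-> a ha.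
    by apply: (p_disj ij kl) => //; rewrite mem_head.
  by apply: (p_disj ij kl) => //; rewrite mem_end.
(* The line from [v i] to [v j], closed by its chord, crosses the triangle [v k], [v l], [v m]
   evenly; this expresses one of the three counts [w] by the other two. *)
have tri i j k l m : i < j < 5 -> k < l -> l < m < 5 -> i != k -> i != l ->
    i != m -> j != k -> j != l -> j != m ->
    w i j k l = w i j l m (+) w i j k m (+) s i j k l (+) s i j l m (+) s i j k m.
  move=> ij kl lm ik il im jk jl jm.
  have km : k < m < 5 by lia.
  have kl5 : k < l < 5 by lia.
  have lm5 : l < m < 5 by lia.
  have dk a : a \in v i :: p i j -> a != v k.
    by move=> ha; apply: (v_neq i j k l) => //; rewrite mem_head.
  have dl a : a \in v i :: p i j -> a != v l.
    by move=> ha; apply: (v_neq i j l m) => //; rewrite mem_head.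
  have dm a : a \in v i :: p i j -> a != v m.
    by move=> ha; apply: (v_neq i j k m) => //; rewrite !inE eqxx orbT.
  have ii : v i \in v i :: p i j by rewrite mem_head.
  have jj := mem_end _ _ ij.
  have : walk_cross q (v i) (p i j ++ [:: v i]) (v k)
      ([:: v l] ++ [:: v m] ++ [:: v k]) = false.
    apply: walk_cross_closed => //; rewrite ?last_cat //= => a b ha.
    have {}ha : a \in v i :: p i j.
      by move: ha; rewrite !(inE, mem_cat) => /or3P[->|->|->]; rewrite ?orbT.
    by rewrite !inE => /or4P[] /eqP-> //; auto.
  have S c d : (forall a, a \in v i :: p i j -> a != c) ->
      (forall a, a \in v i :: p i j -> a != d) ->
      walk_cross q (v j) [:: v i] c [:: d] = cross q (v i) (v j) c d.
    move=> hc hd; rewrite walk_crossC walk_cross_swap //.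
    - by rewrite /walk_cross /= !addbF crossC.
    - by move=> a; rewrite !inE => /orP[] /eqP->; rewrite eq_sym ?hc ?hd.
    - by move=> a; rewrite !inE => /orP[] /eqP->; rewrite eq_sym ?hc ?hd.
  rewrite walk_cross_catl !walk_cross_catr p_last // !S //=.
  have -> : cross q (v i) (v j) (v m) (v k) = cross q (v i) (v j) (v k) (v m).
    rewrite crossC [RHS]crossC; apply: cross_swap => //; rewrite eq_sym.
    - exact: dk.
    - exact: dk.
    - exact: dm.
    - exact: dm.
  rewrite (walk_cross_swap gen dk dm) -/(w i j k l) -/(w i j l m) -/(w i j k m) /s.
  by do 3!case: (w _ _ _ _); do 3!case: (cross _ _ _ _ _).
(* For each of the ten edges, the counts [w] against the opposite triangle add up to three straight
   crossings. A pair of disjoint edges is reached from both of its edges, so these contributions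
   cancel and only the straight-line sum from [split] remains. *)
have := K5_straight_odd; rewrite /K5_sum.
rewrite !split // (tri 0 1 2 3 4) // (tri 0 2 1 3 4) // (tri 0 3 1 2 4) //.
rewrite (tri 0 4 1 2 3) // (tri 1 2 0 3 4) // (tri 1 3 0 2 4) //.
rewrite (tri 1 4 0 2 3) // (tri 2 3 0 1 4) // (tri 2 4 0 1 3) //.
rewrite (tri 3 4 0 1 2) // -!/(s _ _ _ _).
have s_sym i j k l : s i j k l = s k l i j by rewrite /s crossC.
rewrite (s_sym 2 3 0 1) (s_sym 2 4 0 1) (s_sym 3 4 0 1) (s_sym 1 3 0 2).
rewrite (s_sym 1 4 0 2) (s_sym 3 4 0 2) (s_sym 1 2 0 3) (s_sym 1 4 0 3).
rewrite (s_sym 2 4 0 3) (s_sym 1 2 0 4) (s_sym 1 3 0 4) (s_sym 2 3 0 4).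
rewrite (s_sym 3 4 1 2) (s_sym 2 4 1 3) (s_sym 2 3 1 4).
rewrite !addb_xorb => h; apply: etrans h; btauto.
Qed.
End K5.

(** * Walks of a graph as polygonal lines *)

Section PolygonalDrawing.
Import Order.TTheory GRing.Theory Num.Theory.
Variables (R : realType) (G : sgraph) (T : eqType) (q : T -> R * R).
Variables (vtx : G -> T) (owner : T -> G) (sub : G -> G -> seq T).
Hypothesis gen : forall a b c, a != b -> a != c -> b != c ->
  det3 (q a) (q b) (q c) != 0%R.
Hypothesis vtxK : forall x, owner (vtx x) = x.
Hypothesis sub_last : forall x y, last (vtx x) (sub x y) = vtx y.
Hypothesis sub_owner : forall x y t, t \in sub x y -> owner t \in [:: x; y].
Hypothesis sub_cross : forall x y z t, adj x y -> adj z t ->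
  x != z -> x != t -> y != z -> y != t ->
  walk_cross q (vtx x) (sub x y) (vtx z) (sub z t) = false.

Fixpoint poly (x : G) (p : seq G) : seq T :=
  if p is y :: p' then sub x y ++ poly y p' else [::].

Lemma poly_last x p : last (vtx x) (poly x p) = vtx (last x p).
Proof. by elim: p x => [|y p IH] x //=; rewrite last_cat sub_last IH. Qed.

(** Charging each polygon vertex to a vertex of the walk makes lines of disjoint walks disjoint
    without any geometry. *)
Lemma poly_owner x p t : t \in vtx x :: poly x p -> owner t \in x :: p.
Proof.
elim: p x => [|y p IH] x; first by rewrite /= mem_seq1 => /eqP->; rewrite vtxK mem_head.
rewrite /= inE mem_cat => /or3P[/eqP->|/sub_owner|]; first by rewrite vtxK mem_head.
  by rewrite !inE => /orP[] ->; rewrite ?orbT.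
by move=> h; rewrite inE IH ?orbT // inE h orbT.
Qed.

Lemma poly_cross (x y : G) (p p' : seq G) : path (@adj G) x p -> path (@adj G) y p' ->
  (forall a, a \in x :: p -> a \notin y :: p') ->
  walk_cross q (vtx x) (poly x p) (vtx y) (poly y p') = false.
Proof.
elim: p x => [|z p IH] x //= /andP[xz zp] yp' dis.
rewrite walk_cross_catl sub_last (IH z) //; last first.
  by move=> a ha; apply: dis; rewrite inE ha orbT.
have xd := dis x (mem_head _ _).
have {dis IH zp}zd : z \notin y :: p' by apply: dis; rewrite !inE eqxx orbT.
rewrite addbF; elim: p' y yp' xd zd => [|t p' IH] y /=.
  by move=> _ _ _; rewrite walk_crossC.
move=> /andP[yt tp'] xd zd; rewrite walk_cross_catr sub_last IH //; last first.
- by move: zd; rewrite !inE => /norP[].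
- by move: xd; rewrite !inE => /norP[].
move: xd zd; rewrite !inE => /norP[? /norP[? _]] /norP[? /norP[? _]].
by rewrite sub_cross.
Qed.

(** The odd sum of [K5_odd] would consist of zeros. Only walks for disjoint edges of K_5 have to
    avoid each other. *)
Lemma poly_no_K5 (v : nat -> G) (p : nat -> nat -> seq G) :
  (forall i j, i < j < 5 -> v i != v j) ->
  (forall i j, i < j < 5 -> path (@adj G) (v i) (p i j) /\ last (v i) (p i j) = v j) ->
  (forall i j k l, i < j < 5 -> k < l < 5 -> i != k -> i != l -> j != k ->
     j != l -> forall a, a \in v i :: p i j -> a \notin v k :: p k l) -> False.
Proof.
move=> v_inj p_walk p_disj.
have vtx_neq x y : x != y -> vtx x != vtx y.
  by apply: contra_neq => /(congr1 owner); rewrite !vtxK.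
suff: K5_sum (fun i j k l => walk_cross q (vtx (v i)) (poly (v i) (p i j))
                                  (vtx (v k)) (poly (v k) (p k l))).
  have PC i j k l : i < j < 5 -> k < l < 5 -> i != k -> i != l -> j != k ->
      j != l -> walk_cross q (vtx (v i)) (poly (v i) (p i j))
                  (vtx (v k)) (poly (v k) (p k l)) = false.
    move=> ij kl ik il jk jl; apply: poly_cross.
    - exact: (proj1 (p_walk _ _ ij)).
    - exact: (proj1 (p_walk _ _ kl)).
    - exact: p_disj.
  by rewrite /K5_sum !PC.
apply: (@K5_odd _ _ q gen (fun i => vtx (v i))
           (fun i j => poly (v i) (p i j))) => /=.
- by move=> i j ij; apply/vtx_neq/v_inj.
- by move=> i j ij; rewrite poly_last (proj2 (p_walk _ _ ij)).
move=> i j k l ij kl ik il jk jl a b /poly_owner ha /poly_owner hb.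
by apply: contraNneq (p_disj _ _ _ _ ij kl ik il jk jl _ ha) => ->.
Qed.

Definition rpoly x p : seq T := rev (belast (vtx x) (poly x p)).

Lemma rpoly_last x p : last (last (vtx x) (poly x p)) (rpoly x p) = vtx x.
Proof.
by rewrite /rpoly; case: (poly x p) => [|t s] //=; rewrite rev_cons last_rcons.
Qed.

Lemma rpoly_mem x p : last (vtx x) (poly x p) :: rpoly x p =i vtx x :: poly x p.
Proof. by move=> t; rewrite -rev_rcons -lastI mem_rev. Qed.

Lemma rpoly_owner x p t : t \in rpoly x p -> owner t \in x :: p.
Proof.
by move=> h; apply: poly_owner; rewrite -rpoly_mem inE h orbT.
Qed.

Lemma rpoly_cross x p y p' : (forall t, t \in vtx x :: poly x p ->
    t \notin y :: p') ->
  walk_cross q (last (vtx x) (poly x p)) (rpoly x p) y p' =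
  walk_cross q (vtx x) (poly x p) y p'.
Proof.
move=> dis; apply: (walk_cross_rev gen) => a b ha hb.
by apply: contraNneq (dis _ ha) => ->.
Qed.

(* Contracting the path from [u 2] to [w 2] and joining [u 0] to [u 1] through
   [w 2] and [w 0] to [w 1] by a segment turns K_{3,3} into K_5. The segment
   may be crossed, but each of the paths ending in [w 2] occurs twice among the
   edges of K_5 that are disjoint from it. *)
Lemma poly_no_K33 (u w : nat -> G) (p : nat -> nat -> seq G) :
  (forall i j, i < j < 3 -> u i != u j) -> (forall i j, i < j < 3 -> w i != w j) ->
  (forall i j, i < 3 -> j < 3 -> u i != w j) ->
  (forall i j, i < 3 -> j < 3 ->
     path (@adj G) (u i) (p i j) /\ last (u i) (p i j) = w j) ->
  (forall i j k l, i < 3 -> j < 3 -> k < 3 -> l < 3 -> i != k -> j != l ->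
     forall a, a \in u i :: p i j -> a \notin u k :: p k l) -> False.
Proof.
move=> u_inj w_inj uw p_walk p_disj.
have vtx_neq x y : x != y -> vtx x != vtx y.
  by apply: contra_neq => /(congr1 owner); rewrite !vtxK.
pose P i j := poly (u i) (p i j); pose Q i j := rpoly (u i) (p i j).
have P_last i j : i < 3 -> j < 3 -> last (vtx (u i)) (P i j) = vtx (w j).
  by move=> i3 j3; rewrite poly_last (proj2 (p_walk _ _ i3 j3)).
have Q_last i j : i < 3 -> j < 3 -> last (vtx (w j)) (Q i j) = vtx (u i).
  by move=> i3 j3; rewrite -(P_last i j) // rpoly_last.
(* The fifth vertex of K_5 is [u 2], the default of [nth]. The walks between any two of [u 0],
   [u 1], [u 2] pass through [w 2]. *)
pose v i := nth (vtx (u 2)) [:: vtx (u 0); vtx (u 1); vtx (w 0); vtx (w 1)] i.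
pose pp i j := match i, j with
  | 0, 1 => P 0 2 ++ Q 1 2 | 0, 2 => P 0 0 | 0, 3 => P 0 1 | 0, 4 => P 0 2 ++ Q 2 2
  | 1, 2 => P 1 0 | 1, 3 => P 1 1 | 1, 4 => P 1 2 ++ Q 2 2
  | 2, 3 => [:: vtx (w 1)] | 2, 4 => Q 2 0 | _, _ => Q 2 1 end.
have own i j t : t \in Q i j -> owner t \in u i :: p i j by exact: rpoly_owner.
have ownP i j t : t \in vtx (u i) :: P i j -> owner t \in u i :: p i j.
  exact: poly_owner.
have w_mem i j : i < 3 -> j < 3 -> w j \in u i :: p i j.
  by move=> i3 j3; rewrite -(proj2 (p_walk _ _ i3 j3)) mem_last.
have PP i j k l : i < 3 -> j < 3 -> k < 3 -> l < 3 -> i != k -> j != l ->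
    walk_cross q (vtx (u i)) (P i j) (vtx (u k)) (P k l) = false.
  move=> i3 j3 k3 l3 ik jl; apply: poly_cross; first exact: (proj1 (p_walk _ _ i3 j3)).
    exact: (proj1 (p_walk _ _ k3 l3)).
  exact: p_disj.
have Pd i j k l t : i < 3 -> j < 3 -> k < 3 -> l < 3 -> i != k -> j != l ->
    t \in vtx (u i) :: P i j -> t \notin vtx (u k) :: P k l.
  move=> i3 j3 k3 l3 ik jl /ownP ti; apply/negP => /ownP.
  by apply/negP; apply: p_disj ti.
have QC i j y p' : i < 3 -> j < 3 ->
    (forall t, t \in vtx (u i) :: P i j -> t \notin y :: p') ->
    walk_cross q (vtx (w j)) (Q i j) y p' = walk_cross q (vtx (u i)) (P i j) y p'.
  by move=> i3 j3 d; rewrite -(P_last i j) // rpoly_cross.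
have own2 i j k t : t \in vtx (u i) :: (P i j ++ Q k j) ->
    owner t \in u i :: p i j \/ owner t \in u k :: p k j.
  rewrite -cat_cons mem_cat => /orP[/ownP|/own]; first by left.
  by right.
have ownw i j t : i < 3 -> j < 3 -> t \in vtx (w j) :: Q i j -> owner t \in u i :: p i j.
  by move=> i3 j3; rewrite -(P_last i j) // rpoly_mem => /ownP.
have PPd i j k l t t' : i < 3 -> j < 3 -> k < 3 -> l < 3 -> i != k -> j != l ->
    owner t \in u i :: p i j -> owner t' \in u k :: p k l -> t != t'.
  move=> i3 j3 k3 l3 ik jl hi hk.
  by apply: contraNneq (p_disj _ _ _ _ i3 j3 k3 l3 ik jl _ hi) => ->.
have PW i t t' : i < 3 -> owner t \in u i :: p i 2 ->
    t' \in [:: vtx (w 0); vtx (w 1)] -> t != t'.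
  move=> i3 ht; rewrite !inE; pose k := (i == 0) : nat.
  have k3 : k < 3 by rewrite /k; case: eqP.
  have ik : i != k by rewrite /k; case: i {i3 ht k k3} => [|[]].
  case/orP=> /eqP->; [apply: (@PPd i 2 k 0) ht _ | apply: (@PPd i 2 k 1) ht _];
    by rewrite // vtxK w_mem.
have v_inj i j : i < j < 5 -> v i != v j.
  move: i j => [|[|[|[|i]]]] [|[|[|[|[|j]]]]] // H; try lia;
    rewrite /v /=; apply: vtx_neq;
    by [apply: u_inj|apply: w_inj|apply: uw|rewrite eq_sym; apply: uw].
have pp_last i j : i < j < 5 -> last (v i) (pp i j) = v j.
  move: i j => [|[|[|[|i]]]] [|[|[|[|[|j]]]]] // H; try lia;
    by rewrite /v /pp /= ?last_cat ?P_last ?Q_last.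
have pp_disj i j k l : i < j < 5 -> k < l < 5 ->
    i != k -> i != l -> j != k -> j != l ->
    forall a b, a \in v i :: pp i j -> b \in v k :: pp k l -> a != b.
  wlog: i j k l / i < k.
    move=> H ij kl ik il jk jl a b ha hb; case: (ltngtP i k) (ik) => // h _.
      exact: (H i j k l).
    rewrite eq_sym; apply: (H k l i j) => //; by rewrite eq_sym.
  move=> ik ij kl _ il jk jl a b.
  have {ik ij kl il jk jl} : [&& i < k, i < j, j < 5, k < l, l < 5, i != l, j != k & j != l].
    by lia.
  move: i j k l => [|[|[|i]]] [|[|[|[|[|j]]]]] [|[|[|[|k]]]] [|[|[|[|[|l]]]]] // H; try lia.
  all: rewrite /v /pp /=.
  all: try by move=> /own2[] ha hb; apply: PW ha hb.
  all: try by move=> /ownP ha /ownP hb; apply: PPd ha hb.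
  all: try by move=> /ownP ha /own2[] hb; apply: PPd ha hb.
  all: try by move=> /own2[] ha /ownP hb; apply: PPd ha hb.
  all: try by move=> /ownP ha /ownw-/(_ isT isT) hb; apply: PPd ha hb.
  all: try by move=> /own2[] ha /ownw-/(_ isT isT) hb; apply: PPd ha hb.
have seg i t : i < 3 -> t \in vtx (u i) :: P i 2 -> t \notin [:: vtx (w 0); vtx (w 1)].
  by move=> i3 /ownP ht; apply/negP => /(PW _ _ _ i3 ht); rewrite eqxx.
have CC i j k y p' : i < 3 -> j < 3 -> k < 3 ->
    (forall t, t \in vtx (u k) :: P k j -> t \notin y :: p') ->
    walk_cross q (vtx (u i)) (P i j ++ Q k j) y p' =
    walk_cross q (vtx (u i)) (P i j) y p' (+) walk_cross q (vtx (u k)) (P k j) y p'.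
  by move=> i3 j3 k3 d; rewrite walk_cross_catl P_last // QC.
have ZL i j k l m : i < 3 -> j < 3 -> k < 3 -> l < 3 -> m < 3 ->
    i != l -> k != l -> j != m ->
    walk_cross q (vtx (u i)) (P i j ++ Q k j) (vtx (u l)) (P l m) = false.
  move=> *; rewrite CC ?PP // => t; exact: Pd.
have PQ i j l m : i < 3 -> j < 3 -> l < 3 -> m < 3 -> i != l -> j != m ->
    walk_cross q (vtx (u i)) (P i j) (vtx (w m)) (Q l m) = false.
  move=> *; rewrite walk_crossC QC ?PP // 1?eq_sym // => t.
  by apply: Pd; rewrite // eq_sym.
have ZQ i j k l m : i < 3 -> j < 3 -> k < 3 -> l < 3 -> m < 3 ->
    i != l -> k != l -> j != m ->
    walk_cross q (vtx (u i)) (P i j ++ Q k j) (vtx (w m)) (Q l m) = false.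
  move=> *; rewrite CC ?PQ // => t ht; apply/negP => /ownw h.
  have {}h : owner t \in u l :: p l m by apply: h.
  have := PPd k j l m t t; rewrite eqxx => H.
  by suff: false by []; apply: H => //; exact: ownP.
have PZ i j k l m : i < 3 -> j < 3 -> k < 3 -> l < 3 -> m < 3 ->
    i != l -> k != l -> j != m ->
    walk_cross q (vtx (u l)) (P l m) (vtx (u i)) (P i j ++ Q k j) = false.
  by move=> *; rewrite walk_crossC ZL.
have := K5_odd gen v_inj pp_last pp_disj.
rewrite /K5_sum /v /pp /= !(ZL, ZQ, PQ, PZ, PP) //.
rewrite !CC //; do ?[by move=> t; apply: seg].
by do 3!case: (walk_cross _ _ _ _ _).
Qed.
End PolygonalDrawing.

(** * Polygonal approximation of plane drawings *)

Section Topology.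
Import Order.TTheory GRing.Theory Num.Theory.
Variable (R : realType).
Local Open Scope ring_scope.

(** Every point is moved along its own direction (r, r^2), with distinct r. The determinant of three
    moved points is a polynomial in the size of the motion, with a Vandermonde product as
    coefficient of degree 2, so it vanishes for finitely many sizes only. *)
Lemma general_position (T : finType) (pos : T -> R * R) (e : R) : 0 < e ->
  exists q : T -> R * R,
    (forall a b c, a != b -> a != c -> b != c -> det3 (q a) (q b) (q c) != 0) /\
    forall t, `|(q t).1 - (pos t).1| < e /\ `|(q t).2 - (pos t).2| < e.
Proof.
move=> e0; pose r (t : T) : R := (enum_rank t)%:R.
have r_inj : injective r.
  by move=> a b /eqP; rewrite eqr_nat => /eqP /ord_inj /enum_rank_inj.
pose x t : {poly R} := (pos t).1%:P + (r t)%:P * 'X.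
pose y t : {poly R} := (pos t).2%:P + ((r t) ^+ 2)%:P * 'X.
pose D a b c : {poly R} := (x b - x a) * (y c - y a) - (y b - y a) * (x c - x a).
have D_coef a b c : (D a b c)`_2 = (r b - r a) * (r c - r a) * (r c - r b).
  have -> : D a b c =
    (((pos b).1 - (pos a).1) * ((pos c).2 - (pos a).2) -
     ((pos b).2 - (pos a).2) * ((pos c).1 - (pos a).1))%:P +
    (((pos b).1 - (pos a).1) * (r c ^+ 2 - r a ^+ 2) +
     (r b - r a) * ((pos c).2 - (pos a).2) -
     ((pos b).2 - (pos a).2) * (r c - r a) -
     (r b ^+ 2 - r a ^+ 2) * ((pos c).1 - (pos a).1))%:P * 'X +
    ((r b - r a) * (r c - r a) * (r c - r b))%:P * 'X^2.
    rewrite /D /x /y !(polyCD, polyCB, polyCM, polyCN, polyC_exp); ring.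
  by rewrite !coefE /= mulr0 mulr1 !add0r.
pose P : {poly R} := \prod_(w : T * T * T | [&& w.1.1 != w.1.2, w.1.1 != w.2 &
   w.1.2 != w.2]) D w.1.1 w.1.2 w.2.
have P0 : P != 0.
  apply/prodf_neq0 => -[[a b] c] /and3P[/= ab ac bc].
  have : (D a b c)`_2 != 0.
    by rewrite D_coef !mulf_neq0 // subr_eq0 (inj_eq r_inj) // eq_sym.
  by apply: contra_neq => ->; rewrite coef0.
pose M : R := 1 + \sum_t (`|r t| + `|r t ^+ 2|).
have M0 : 0 < M by rewrite ltr_pwDl // sumr_ge0 // => t _; rewrite addr_ge0.
pose z k : R := e / M / k.+1%:R.
have z_inj : injective z.
  move=> k l /(congr1 (fun u => u^-1)); rewrite /z !invf_div => /mulIf H.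
  have /H/eqP : M / e != 0 by rewrite mulf_neq0 ?invr_eq0 ?gt_eqF.
  by rewrite eqr_nat => /eqP[].
(* The [size P] distinct candidates outnumber the roots of [P]. *)
have [k _ kP] : exists2 k, k \in iota 0 (size P) & ~~ root P (z k).
  apply/hasP; rewrite has_predC; apply/negP => /allP rP.
  have := @max_poly_roots _ P [seq z k | k <- iota 0 (size P)] P0.
  rewrite size_map size_iota ltnn map_inj_uniq ?iota_uniq //.
  by move=> H; suff: false by []; apply: H => //; apply/allP => _ /mapP[k /rP ? ->].
have z0 : 0 < z k by rewrite /z !divr_gt0.
have zM : z k * M <= e.
  rewrite /z mulrAC divfK ?gt_eqF // ler_pdivrMr // ler_peMr ?ler1n //.
  exact: ltW.
move: (z k) z0 zM kP => {z_inj} {}z z0 zM zP.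
exists (fun t => ((x t).[z], (y t).[z])); split.
  move=> a b c ab ac bc; have : D a b c %| P.
    by rewrite /P (bigD1 (a, b, c)) ?ab ?ac ?bc //= dvdp_mulIl.
  rewrite /det3 /= => /dvdpP[p' Pp]; apply: contra zP => /eqP E.
  by rewrite Pp /root hornerM /D !hornerE in E *; rewrite E mulr0.
have B t : `|r t| < M /\ `|r t ^+ 2| < M.
  have : `|r t| + `|r t ^+ 2| < M.
    by rewrite /M (bigD1 t) //= ltr_pwDl // lerDl sumr_ge0.
  have := normr_ge0 (r t); have := normr_ge0 (r t ^+ 2); lra.
move=> t; have [B1 B2] := B t.
split; rewrite /= /x /y !hornerE addrC addKr normrM (gtr0_norm z0);
  by apply: lt_le_trans zM; rewrite mulrC ltr_pM2l.
Qed.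

(** Crossing segments have a common point, at parameter A / (A - B) of the first and C / (C - D) of
    the second; the bound is the triangle inequality through it. It is used in contrapositive form:
    short segments far apart do not cross. *)
Lemma cross_close (T : eqType) (q : T -> R * R) a b c d : cross q a b c d ->
  `|(q a).1 - (q c).1| <= `|(q a).1 - (q b).1| + `|(q c).1 - (q d).1| /\
  `|(q a).2 - (q c).2| <= `|(q a).2 - (q b).2| + `|(q c).2 - (q d).2|.
Proof.
set A := det3 (q c) (q d) (q a); set B := det3 (q c) (q d) (q b).
set C := det3 (q a) (q b) (q c); set D := det3 (q a) (q b) (q d).
rewrite /cross /ccw -/A -/B -/C -/D => /andP[CD AB].
have wE : A - B = D - C by rewrite /A /B /C /D /det3; ring.
have unit_ratio (x y : R) : (0 < x) (+) (0 < y) ->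
    0 <= x / (x - y) <= 1 /\ x - y != 0.
  case: (ltP 0 x) (ltP 0 y) => hx [] hy //= _.
    have xy : 0 < x - y by lra.
    by rewrite divr_ge0 ?(ltW hx) ?(ltW xy) // ler_pdivrMr // gt_eqF // mul1r; split=> //; lra.
  have xy : 0 < y - x by lra.
  rewrite -[x - y]opprB invrN mulrN -mulNr.
  rewrite divr_ge0 ?(ltW xy) // ?oppr_ge0 // ler_pdivrMr // mul1r oppr_eq0.
  by rewrite gt_eqF //; split=> //; lra.
have [/andP[s0 s1] w0] := unit_ratio _ _ AB.
have [/andP[t0 t1] w0'] := unit_ratio _ _ CD.
have key (u v x y : R) : u + A / (A - B) * (v - u) = x + C / (C - D) * (y - x) ->
    `|u - x| <= `|u - v| + `|x - y|.
  move=> E; have -> : u - x = C / (C - D) * (y - x) - A / (A - B) * (v - u) by lra.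
  apply: (le_trans (ler_normB _ _)); rewrite (normrM (A / _)) (normrM (C / _)).
  rewrite (ger0_norm s0) (ger0_norm t0) addrC.
  rewrite (distrC v u) (distrC y x).
  by apply: lerD; apply: ler_piMl.
have E : C / (C - D) = - C / (A - B).
  by rewrite wE -[C - D]opprB invrN mulrN mulNr.
by split; apply: key; rewrite E; move: w0; rewrite /A /B /C /det3 => w0; field.
Qed.
End Topology.

Section Arcs.
Import Order.TTheory GRing.Theory Num.Theory.
Import numFieldNormedType.Exports.
Variable (R : realType).
Local Open Scope ring_scope.
Implicit Types (c : R -> R * R) (s t d e : R).

Lemma continuous_within_segment c : {within `[0, 1], continuous c} ->
  forall s e, 0 <= s <= 1 -> 0 < e ->
  exists2 d, 0 < d & forall t, 0 <= t <= 1 -> `|s - t| < d -> `|c s - c t| < e.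
Proof.
move=> /subspace_continuousP cc s e s01 e0.
have /cvgrPdist_lt /(_ e e0) : c x @[x --> within `[0, 1]%classic (nbhs s)] --> c s.
  by apply: cc; rewrite /= in_itv.
rewrite near_withinE => /nbhs_ballP[d /= d0 H]; exists d => // t t01 st.
by apply: H => //; rewrite /= in_itv.
Qed.

(** Compactness of the unit square, stated for an abstract property that survives shrinking the
    scale, so that uniform continuity and the positive distance of disjoint arcs both follow from
    it. *)
Lemma square_lebesgue (P : R -> R -> R -> Prop) :
  (forall d d' s t, d' <= d -> P d s t -> P d' s t) ->
  (forall s t, 0 <= s <= 1 -> 0 <= t <= 1 -> exists2 d, 0 < d &
     forall s' t', 0 <= s' <= 1 -> 0 <= t' <= 1 -> `|s - s'| < d ->
       `|t - t'| < d -> P d s' t') ->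
  exists2 d, 0 < d & forall s t, 0 <= s <= 1 -> 0 <= t <= 1 -> P d s t.
Proof.
move=> mono loc.
have K : compact (`[0, 1]%classic `*` `[0, 1]%classic : set (R * R)).
  by apply: compact_setX; exact: segment_compact.
move/compact_near_coveringP: K => /(_ R 0^'+
  (fun d st => 0 <= st.1 <= 1 -> 0 <= st.2 <= 1 -> P d st.1 st.2)).
case.
  move=> [s t] [/= s01 t01]; rewrite !in_itv /= in s01 t01.
  have [d d0 H] := loc _ _ s01 t01.
  exists (ball (s, t) d, [set x | 0 < x <= d]).
    split; first exact: nbhsx_ballx.
    exists d => //= x; rewrite /ball /= sub0r normrN => xd x0.
    by rewrite x0 ltW // -(gtr0_norm x0).
  move=> [[s' t'] d'] /= [[/= ss tt] /andP[d'0 d'd]] s'01 t'01.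
  exact/(mono d)/H.
move=> d /= d0 H; exists (d / 2); first by rewrite divr_gt0.
move=> s t s01 t01; apply: (H (d / 2) _ _ (s, t)) => //=; rewrite ?in_itv //=.
  by rewrite /ball /= sub0r normrN gtr0_norm ?divr_gt0 // ltr_pdivrMr // ltr_pMr // ltr1n.
by rewrite divr_gt0.
Qed.

Lemma uniformly_continuous_segment c : {within `[0, 1], continuous c} ->
  forall e, 0 < e -> exists2 d, 0 < d &
  forall s t, 0 <= s <= 1 -> 0 <= t <= 1 -> `|s - t| < d -> `|c s - c t| < e.
Proof.
move=> cc e e0.
apply: (@square_lebesgue (fun d s t => `|s - t| < d -> `|c s - c t| < e)).
  by move=> d d' s t dd H h; apply: H; apply: lt_le_trans dd.
move=> s t s01 t01; case: (eqVneq s t) => [st|st].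
  have e20 : 0 < e / 2 by rewrite divr_gt0.
  have [d d0 H] := continuous_within_segment cc s01 e20.
  exists d => // s' t' s'01 t'01 ss tt _; rewrite -st in tt.
  apply: le_lt_trans (ler_distD (c s) _ _) _.
  have := H _ s'01 ss; have := H _ t'01 tt; rewrite (distrC (c s')).
  by move=> h1 h2; rewrite (splitr e) ltrD.
(* Off the diagonal the claim is vacuous: at a third of the distance, no pair near (s, t) is within
   the scale of each other. *)
have st0 : 0 < `|s - t| by rewrite normr_gt0 subr_eq0.
exists (`|s - t| / 3); first by rewrite divr_gt0.
move=> s' t' s'01 t'01 ss tt st'; exfalso.
have := ler_distD s' s t; have := ler_distD t' s' t; rewrite (distrC t' t).
lra.
Qed.

Lemma disjoint_arcs_separated c c' :
  {within `[0, 1], continuous c} -> {within `[0, 1], continuous c'} ->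
  (forall s t, 0 <= s <= 1 -> 0 <= t <= 1 -> c s <> c' t) ->
  exists2 d, 0 < d & forall s t, 0 <= s <= 1 -> 0 <= t <= 1 ->
    d <= `|c s - c' t|.
Proof.
move=> cc cc' dis; apply: square_lebesgue.
  by move=> d d' s t; apply: le_trans.
move=> s t s01 t01.
have st0 : 0 < `|c s - c' t| by rewrite normr_gt0 subr_eq0; apply/eqP/dis.
have e0 : 0 < `|c s - c' t| / 3 by rewrite divr_gt0.
have [d1 d10 H1] := continuous_within_segment cc s01 e0.
have [d2 d20 H2] := continuous_within_segment cc' t01 e0.
exists (Num.min (`|c s - c' t| / 3) (Num.min d1 d2)); first by rewrite !lt_min e0 d10.
move=> s' t' s'01 t'01; rewrite !lt_min => /and3P[_ ss _] /and3P[_ _ tt].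
apply: (@le_trans _ _ (`|c s - c' t| / 3)); first by rewrite ge_min lexx.
have := H1 _ s'01 ss; have := H2 _ t'01 tt.
have := ler_distD (c s') (c s) (c' t); have := ler_distD (c' t') (c s') (c' t).
rewrite (distrC (c' t')); lra.
Qed.
End Arcs.

Section Planar.
Import Order.TTheory GRing.Theory Num.Theory.
Import numFieldNormedType.Exports.
Variable (R : realType).

Lemma common_scale (I : finType) (P : I -> R -> Prop) :
  (forall i d d', (d' <= d)%R -> P i d -> P i d') ->
  (forall i, exists2 d, (0 < d)%R & P i d) -> exists2 d, (0 < d)%R & forall i, P i d.
Proof.
move=> mono H.
have /choice[f fP] : forall i, exists d, (0 < d)%R /\ P i d.
  by move=> i; have [d d0 dP] := H i; exists d.
exists (\big[Order.min/1%R]_i f i).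
  by apply: lt_bigmin => // i _; case: (fP i).
by move=> i; apply: mono (bigmin_le _ i f) _; case: (fP i).
Qed.

(** Arcs are sampled so densely, and the samples moved so little, that a crossing of lines for
    disjoint edges would bring their arcs closer than their distance. Nothing is claimed about edges
    with a common end. *)
Lemma planar_polygonal (G : sgraph) : planar R G ->
  exists (T : finType) (q : T -> R * R) (vtx : G -> T) (owner : T -> G)
    (sub : G -> G -> seq T),
  [/\ forall a b c, a != b -> a != c -> b != c -> det3 (q a) (q b) (q c) != 0%R,
      forall x, owner (vtx x) = x,
      forall x y, last (vtx x) (sub x y) = vtx y,
      forall x y t, t \in sub x y -> owner t \in [:: x; y] &
      forall x y z t, adj x y -> adj z t ->
        x != z -> x != t -> y != z -> y != t ->
        walk_cross q (vtx x) (sub x y) (vtx z) (sub z t) = false].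
Proof.
move=> [pt [arc [pt_inj arcP arc_pt arc_meet]]].
have /choice[c cP] : forall xy : G * G, exists c : R -> R * R, adj xy.1 xy.2 ->
    [/\ {within `[0%R, 1%R], continuous c}, c 0%R = pt xy.1, c 1%R = pt xy.2
      & forall s : R, (0 <= s <= 1)%R -> arc xy.1 xy.2 (c s)].
  move=> [x y] /=; case: (boolP (adj x y)) => [xy|_]; last by exists (fun=> 0%R).
  have [[c [c1 _ c2 c3 ->]] _] := arcP _ _ xy; exists c => _; split=> //.
have [d d0 dP] : exists2 d : R, (0 < d)%R & forall i : G * G * (G * G),
    adj i.1.1 i.1.2 -> adj i.2.1 i.2.2 -> i.1.1 != i.2.1 -> i.1.1 != i.2.2 ->
    i.1.2 != i.2.1 -> i.1.2 != i.2.2 -> forall s t : R, (0 <= s <= 1)%R ->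
    (0 <= t <= 1)%R -> (d <= `|c i.1 s - c i.2 t|)%R.
  apply: common_scale.
    move=> i d d' dd H h1 h2 h3 h4 h5 h6 s t hs ht.
    by apply: le_trans dd _; apply: H.
  move=> [[x y] [z t]] /=.
  case: (boolP [&& adj x y, adj z t, x != z, x != t, y != z & y != t]); last first.
    move=> H; exists 1%R => // h1 h2 h3 h4 h5 h6; move: H.
    by rewrite h1 h2 h3 h4 h5 h6.
  case/and5P => xy zt xz xt /andP[yz yt].
  have [c1 _ _ c2] := cP (x, y) xy; have [c1' _ _ c2'] := cP (z, t) zt.
  have [|d d0 H] := disjoint_arcs_separated c1 c1'; last by exists d.
  move=> s s' s01 s'01 E.
  have [||w _ Ew] := arc_meet x y z t xy zt _ (c (x, y) s).
  - apply: contraNneq xz => /setP/(_ x); rewrite !inE eqxx /= => /esym/orP[->//|].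
    by rewrite (negPf xt).
  - by split; [apply: c2|rewrite E; apply: c2'].
  have h1 : w = x \/ w = y by apply: (arc_pt _ _ _ xy); rewrite Ew; apply: c2.
  have h2 : w = z \/ w = t by apply: (arc_pt _ _ _ zt); rewrite Ew E; apply: c2'.
  case: h1 h2 => -> [] h; first by rewrite h eqxx in xz.
  - by rewrite h eqxx in xt.
  - by rewrite h eqxx in yz.
  - by rewrite h eqxx in yt.
(* After perturbation every segment has length below 3 e in each coordinate, so a crossing would
   bring two samples within 3 e + 3 e + 2 e = 8 e of each other; 20 leaves room. *)
pose e : R := (d / 20)%R.
have e0 : (0 < e)%R by rewrite divr_gt0.
have [h h0 hP] : exists2 h : R, (0 < h)%R & forall xy : G * G, adj xy.1 xy.2 ->
    forall s t : R, (0 <= s <= 1)%R -> (0 <= t <= 1)%R -> (`|s - t| < h)%R ->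
    (`|c xy s - c xy t| < e)%R.
  apply: common_scale.
    move=> xy h h' hh H xyE s t s01 t01 st.
    by apply: H => //; apply: lt_le_trans hh.
  move=> xy; case: (boolP (adj xy.1 xy.2)) => [xyE|_]; last by exists 1%R.
  have [c1 _ _ _] := cP _ xyE.
  by have [h h0 H] := uniformly_continuous_segment c1 e0; exists h.
pose N := Num.truncn (h^-1)%R.
have hN : (N.+1%:R^-1 < h)%R.
  by rewrite invf_plt ?posrE // truncnS_gt.
(* For adjacent x and y the label (x, y, k) is the k-th sample of the arc from x to y. The label (x,
   x, 0) is the vertex x, placed by the second branch of [pos] as x is not adjacent to itself. The
   first and last samples lie on the ends of the arc but have labels of their own; the perturbation
   separates them. *)
pose T : finType := (G * G * 'I_N.+2)%type.
pose pos (t : T) : R * R :=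
  if adj t.1.1 t.1.2 then c t.1 (t.2%:R / N.+1%:R)%R else pt t.1.1.
pose vtx x : T := (x, x, ord0).
pose sub x y : seq T := rcons [seq (x, y, inord k) | k <- iota 0 N.+2] (vtx y).
have [q [gen near_pos]] := @general_position R T pos e e0.
exists T, q, vtx, (fun t => t.1.1), sub; split=> //.
- by move=> x y; rewrite last_rcons.
- move=> x y t; rewrite mem_rcons inE => /orP[/eqP->|/mapP[k _ ->]];
    by rewrite !inE /= eqxx ?orbT.
pose on x y (t : T) := [\/ t = vtx x, t = vtx y | t.1 = (x, y)].
pose step x y (a b : T) := on x y a /\ (`|pos a - pos b| < e)%R.
have pos_vtx x : pos (vtx x) = pt x by rewrite /pos /= adj_irr.
have pos_mid x y k : adj x y -> k <= N.+1 ->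
    pos (x, y, inord k) = c (x, y) (k%:R / N.+1%:R)%R.
  by move=> xy kN; rewrite /pos /= xy inordK.
have frac01 k : k <= N.+1 -> (0 <= (k%:R / N.+1%:R : R) <= 1)%R.
  by move=> kN; rewrite divr_ge0 // ler_pdivrMr // mul1r ler_nat.
have on_arc x y a : adj x y -> on x y a ->
    exists2 s : R, (0 <= s <= 1)%R & pos a = c (x, y) s.
  move=> xy; have [_ c0 c1 _] := cP (x, y) xy; rewrite /= in c0 c1.
  case=> [->|->|].
  - by exists 0%R; rewrite ?lexx ?ler01 // pos_vtx c0.
  - by exists 1%R; rewrite ?lexx ?ler01 // pos_vtx c1.
  case: a => [[x' y'] k] /= [-> ->]; exists (k%:R / N.+1%:R)%R.
    by rewrite frac01 // -ltnS.
  by rewrite /pos /= xy.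
have sub_step x y : adj x y -> path (fun a b => `[< step x y a b >]) (vtx x) (sub x y).
  move=> xy; have [_ c0 c1 _] := cP (x, y) xy; rewrite /= in c0 c1.
  have mid_path n k : k + n = N.+1 ->
      path (fun a b => `[< step x y a b >]) (x, y, inord k)
        [seq (x, y, inord l) | l <- iota k.+1 n].
    elim: n k => [|n IH] k //= kn; rewrite IH; last by lia.
    rewrite andbT; apply/asboolP; split; first by constructor 3.
    rewrite !pos_mid //; try lia.
    apply: (hP (x, y)) => //; try by apply: frac01; lia.
    by rewrite distrC -mulrBl -natrB // subSnn mul1r gtr0_norm // invr_gt0 ltr0n.
  have lastE : last (x, y, inord 0) [seq (x, y, inord k) | k <- iota 1 N.+1] =
            (x, y, inord N.+1) :> T.
    rewrite (last_map (fun k => (x, y, inord k) : T)); congr (_, inord _).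
    by rewrite (last_nth 0) size_iota -[nth _ _ _]/(nth 0 (iota 1 N.+1) N) nth_iota.
  have subE : sub x y = (x, y, inord 0) ::
      rcons [seq (x, y, inord k) | k <- iota 1 N.+1] (vtx y) by [].
  rewrite subE; move: (mid_path N.+1 0 erefl) lastE.
  move: [seq _ | _ <- _] => s s_path s_last.
  rewrite /= rcons_path s_path s_last /=.
  apply/andP; split; apply/asboolP.
    split; first by constructor 1.
    by rewrite pos_vtx pos_mid // mul0r c0 subrr normr0.
  split; first by constructor 3.
  by rewrite pos_vtx pos_mid // divff ?pnatr_eq0 // c1 subrr normr0.
move=> x y z t xy zt xz xt yz yt.
apply: (walk_sum_path _ (sub_step _ _ xy)) => a b /asboolP[ona ab].
apply: (walk_sum_path _ (sub_step _ _ zt)) => a' b' /asboolP[ona' ab'].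
have [s s01 Es] := on_arc _ _ _ xy ona; have [s' s'01 Es'] := on_arc _ _ _ zt ona'.
have /= := dP ((x, y), (z, t)) xy zt xz xt yz yt _ _ s01 s'01.
rewrite -Es -Es'; apply: contraTF => /cross_close.
have normE (u v : R * R) (m : R) :
    (`|u - v| < m)%R = (`|u.1 - v.1| < m)%R && (`|u.2 - v.2| < m)%R.
  by rewrite /Num.norm /= gt_max.
rewrite -ltNge !normE in ab ab' *.
move: (near_pos a) (near_pos b) (near_pos a') (near_pos b') ab ab'.
rewrite /e => -[a1 a2] [b1 b2] [a'1 a'2] [b'1 b'2] /andP[ab1 ab2] /andP[ab'1 ab'2].
have tri (u v w z1 p r s1 t1 : R) : (`|u - p| < d / 20 -> `|v - r| < d / 20 ->
   `|w - s1| < d / 20 -> `|z1 - t1| < d / 20 -> `|p - r| < d / 20 ->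
   `|s1 - t1| < d / 20 -> `|u - w| <= `|u - v| + `|w - z1| -> `|p - s1| < d)%R.
  move=> h1 h2 h3 h4 h5 h6 h7.
  have := ler_distD p u v; have := ler_distD r p v; have := ler_distD s1 w z1.
  have := ler_distD t1 s1 z1; have := ler_distD u p s1; have := ler_distD w u s1.
  by rewrite (distrC r) (distrC t1) (distrC p u); lra.
by case=> c1 c2; rewrite (tri _ _ _ _ _ _ _ _ a1 b1 a'1 b'1) //
  (tri _ _ _ _ _ _ _ _ a2 b2 a'2 b'2).
Qed.
End Planar.

(** * Excluded minors *)

Lemma ltn_bounds i j n : i < j < n -> [/\ i < n, j < n & i != j].
Proof. by move=> ij; split; lia. Qed.

Section Minors.
Variables (R : realType) (G : sgraph) (planarG : planar R G).
Implicit Types (a b x y : G) (B p : seq G).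

(** The walk steps to a neighbour of [a] on the contracted path and runs back along it to its head,
    which represents the branch set. *)
Lemma walk_to_head a b B : path (@adj G) b B -> has (adj a) (b :: B) ->
  exists2 p, path (@adj G) a p /\ last a p = b & {subset p <= b :: B}.
Proof.
move=> bB /hasP[e eB ae]; case/splitPl: eB bB => p1 p2 e1.
rewrite cat_path => /andP[bp1 _]; exists (e :: rev (belast b p1)).
  split.
    rewrite /= ae -e1 /= rev_path.
    by rewrite (eq_path (e' := @adj G)) // => x y; rewrite adj_sym.
  by rewrite /= -e1; case: p1 {bp1 e1} => [|c p1] //=; rewrite rev_cons last_rcons.
move=> x; rewrite -cat_cons mem_cat (lastI b) mem_rcons -e1 !inE mem_rev.
by move=> /orP[->|->]; rewrite ?orbT.
Qed.

(** The four walks to the head [b] may share vertices of [B]: they stand for edges of K_5 with a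
    common end. *)
Lemma no_K5_minor a1 a2 a3 a4 b B :
  uniq (a1 :: a2 :: a3 :: a4 :: b :: B) -> path (@adj G) b B ->
  adj a1 a2 -> adj a1 a3 -> adj a1 a4 -> adj a2 a3 -> adj a2 a4 -> adj a3 a4 ->
  has (adj a1) (b :: B) -> has (adj a2) (b :: B) -> has (adj a3) (b :: B) ->
  has (adj a4) (b :: B) -> False.
Proof.
have [T [q [vtx [owner [sub [gen vtxK s_last s_owner s_cross]]]]]] :=
  planar_polygonal planarG.
move=> U bB a12 a13 a14 a23 a24 a34.
move=> /(walk_to_head bB)[p1 [w1 l1] s1] /(walk_to_head bB)[p2 [w2 l2] s2].
move=> /(walk_to_head bB)[p3 [w3 l3] s3] /(walk_to_head bB)[p4 [w4 l4] s4].
(* Defaults of [nth] carry the last entries: [v 4] is [b], and [p 3 4] is [p4]. *)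
pose v i := nth b [:: a1; a2; a3; a4] i.
pose p i j := if j < 4 then [:: v j] else nth p4 [:: p1; p2; p3] i.
have v_uniq : uniq [:: a1; a2; a3; a4; b].
  by move: U; rewrite -[_ :: _ :: _]/([:: a1; a2; a3; a4; b] ++ B) cat_uniq => /andP[].
have v5 i : v i = nth b [:: a1; a2; a3; a4; b] i.
  by move: i => [|[|[|[|[|i]]]]]; rewrite /v //= !nth_nil.
have v_eq i j : i < 5 -> j < 5 -> (v i == v j) = (i == j).
  by move=> i5 j5; rewrite !v5 nth_uniq.
have p4_sub i : {subset p i 4 <= b :: B}.
  by rewrite /p /=; move: i => [|[|[|i]]] //=; rewrite nth_nil.
have v_notin i : i < 4 -> v i \notin b :: B.
  move=> i4; have : v i \in [:: a1; a2; a3; a4] by apply: mem_nth.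
  move: U; rewrite -[a1 :: _]/([:: a1; a2; a3; a4] ++ (b :: B)) cat_uniq.
  by case/and3P => _ /hasPn H _; apply: contraL => /H.
apply: (@poly_no_K5 R G T q vtx owner sub gen vtxK s_last s_owner s_cross v p).
- by move=> i j /ltn_bounds[i5 j5 ij]; rewrite v_eq.
- move=> i j; move: i j => [|[|[|[|i]]]] [|[|[|[|[|j]]]]] // H;
    by [case: (ltn_bounds H)|rewrite /p /v /= ?andbT].
move=> i j k l ij kl ik il jk jl x.
have mem_p i' j' : i' < j' < 5 -> x \in v i' :: p i' j' ->
    exists2 m, m \in [:: i'; j'] & if m == 4 then x \in b :: B else x == v m.
  move=> ij'; rewrite inE => /orP[/eqP->|xp].
    exists i'; rewrite ?mem_head // ltn_eqF //.
    by case/andP: ij' => ij' j5; apply: leq_trans ij' _.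
  exists j'; rewrite ?inE ?eqxx ?orbT //; move: xp; case: eqP => [->|j4].
    exact: p4_sub.
  have [_ j5 _] := ltn_bounds ij'.
  by rewrite /p ifT ?mem_seq1 //; rewrite ltn_neqAle -ltnS j5 andbT; apply/eqP.
move=> /(mem_p _ _ ij)[m hm xm]; apply/negP => /(mem_p _ _ kl)[n hn xn].
have mn : m != n.
  by move: hm hn; rewrite !inE => /orP[]/eqP-> /orP[]/eqP->.
have [i5 j5 _] := ltn_bounds ij; have [k5 l5 _] := ltn_bounds kl.
have m5 : m < 5 by move: hm; rewrite !inE => /orP[]/eqP->.
have n5 : n < 5 by move: hn; rewrite !inE => /orP[]/eqP->.
move: xm xn; case: (eqVneq m 4) => m4; case: (eqVneq n 4) => n4.
- by rewrite m4 n4 eqxx in mn.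
- move=> xB /eqP xn; have : v n \notin b :: B by apply: v_notin; rewrite ltn_neqAle n4.
  by rewrite -xn xB.
- move=> /eqP xn xB; have : v m \notin b :: B by apply: v_notin; rewrite ltn_neqAle m4.
  by rewrite -xn xB.
by move=> /eqP->; rewrite v_eq // (negPf mn).
Qed.

(** Walks into the same contracted path may overlap, as the corresponding edges of K_{3,3} share an
    end; different paths are disjoint by the uniqueness condition. *)
Lemma no_K33_minor a1 a2 a3 b1 B1 b2 B2 b3 B3 :
  uniq ([:: a1; a2; a3] ++ (b1 :: B1) ++ (b2 :: B2) ++ (b3 :: B3)) ->
  path (@adj G) b1 B1 -> path (@adj G) b2 B2 -> path (@adj G) b3 B3 ->
  has (adj a1) (b1 :: B1) -> has (adj a1) (b2 :: B2) -> has (adj a1) (b3 :: B3) ->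
  has (adj a2) (b1 :: B1) -> has (adj a2) (b2 :: B2) -> has (adj a2) (b3 :: B3) ->
  has (adj a3) (b1 :: B1) -> has (adj a3) (b2 :: B2) -> has (adj a3) (b3 :: B3) ->
  False.
Proof.
have [T [q [vtx [owner [sub [gen vtxK s_last s_owner s_cross]]]]]] :=
  planar_polygonal planarG.
move=> U w1 w2 w3 h11 h12 h13 h21 h22 h23 h31 h32 h33.
pose u i := nth a3 [:: a1; a2] i.
pose b i := nth b3 [:: b1; b2] i.
pose B i := nth B3 [:: B1; B2] i.
have /choice[p pP] : forall ij : nat * nat, exists p, ij.1 < 3 -> ij.2 < 3 ->
    [/\ path (@adj G) (u ij.1) p, last (u ij.1) p = b ij.2 &
       {subset p <= b ij.2 :: B ij.2}].
  move=> [i j] /=; case: (boolP ((i < 3) && (j < 3))); last first.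
    by move=> h; exists [::] => i3 j3; rewrite i3 j3 in h.
  move=> /andP[i3 j3].
  have [||p' [c1 c2] c3] := @walk_to_head (u i) (b j) (B j).
  - by move: j j3 => [|[|[|j]]].
  - by move: i j i3 j3 => [|[|[|i]]] [|[|[|j]]].
  by exists p'.
have bu i j x : i < 3 -> j < 3 -> x \in b j :: B j -> x != u i.
  move=> i3 j3 xb; apply: contraTneq U => E.
  have xu : x \in [:: a1; a2; a3].
    by rewrite E /u; move: i i3 {E} => [|[|[|i]]] // _; rewrite !inE eqxx ?orbT.
  have xB : x \in (b1 :: B1) ++ (b2 :: B2) ++ (b3 :: B3).
    by move: xb; rewrite !mem_cat; move: j j3 => [|[|[|j]]] // _ ->; rewrite ?orbT.
  by rewrite cat_uniq negb_and; apply/orP; right; rewrite negb_and negbK; apply/orP; left;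
    apply/hasP; exists x.
have bb j l x : j < 3 -> l < 3 -> j != l -> x \in b j :: B j -> x \notin b l :: B l.
  wlog: j l / j < l.
    move=> H j3 l3 jl; case: (ltngtP j l) (jl) => // h _; first exact: H.
    by apply: contraL; apply: H; rewrite // eq_sym.
  move=> jl j3 l3 _.
  move: U; rewrite cat_uniq => /and3P[_ _]; rewrite cat_uniq => /and3P[_ /hasPn d1].
  rewrite cat_uniq => /and3P[_ /hasPn d2 _].
  move: j l jl j3 l3 => [|[|[|j]]] [|[|[|l]]] //= _ _ _; rewrite /b /B /= => xj;
    apply: contraL xj => xl; [apply: d1|apply: d1|apply: d2] => //;
    by rewrite mem_cat xl ?orbT.
have uu : uniq [:: a1; a2; a3] by move: U; rewrite cat_uniq => /and3P[].
have b_mem j : b j \in b j :: B j by rewrite mem_head.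
apply: (@poly_no_K33 R G T q vtx owner sub gen vtxK s_last s_owner s_cross u b
          (fun i j => p (i, j))).
- move=> i j /ltn_bounds[i3 j3 ij].
  have E k : k < 3 -> u k = nth a1 [:: a1; a2; a3] k by move: k => [|[|[|k]]].
  by rewrite !E ?nth_uniq.
- move=> i j /ltn_bounds[i3 j3 ij'].
  by apply: contraNneq (bb _ _ _ i3 j3 ij' (b_mem i)) => ->.
- by move=> i j i3 j3; rewrite eq_sym; apply: (bu i j).
- by move=> i j i3 j3; have [] := pP (i, j) i3 j3.
move=> i j k l i3 j3 k3 l3 ik jl x.
have [_ _ s1] := pP (i, j) i3 j3; have [_ _ s2] := pP (k, l) k3 l3.
rewrite !inE negb_or => /orP[/eqP->|/s1 xj].
  rewrite (_ : u i != u k) /=; last first.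
    move: uu ik; rewrite /= !inE !negb_or => /and3P[/andP[n1 n2] n3 _].
    by move: i k i3 k3 {s1 s2} => [|[|[|i]]] [|[|[|k]]] //= _ _ _; rewrite /u /= 1?eq_sym.
  by apply/negP => /s2 /(bu i) => /(_ i3 l3); rewrite eqxx.
rewrite (bu k j) //=; apply/negP => /s2; apply/negP; exact: bb xj.
Qed.
End Minors.

(** * Tactics for the side conditions of minors *)

Ltac solve_adj := solve [assumption | rewrite adj_sym; assumption].

Ltac adj_absurd :=
  match goal with
  | H : is_true (@adj _ ?x ?x) |- _ => by rewrite adj_irr in H
  | H : is_true (?x != ?x) |- _ => by rewrite eqxx in H
  | H1 : is_true (@adj _ ?x ?y), H2 : is_true (~~ @adj _ ?x ?y) |- _ =>
      by rewrite H1 in H2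
  | H1 : is_true (@adj _ ?x ?y), H2 : is_true (~~ @adj _ ?y ?x) |- _ =>
      by rewrite adj_sym H1 in H2
  end.

(* [subst] rewrites all hypotheses: without clearing, lemmas would depend on section
   hypotheses that they do not use. *)
Ltac solve_neq :=
  solve [assumption | rewrite eq_sym; assumption
        | repeat match goal with H : forall _, _ |- _ => clear H end;
          apply/eqP => ?; subst; adj_absurd].

Ltac solve_uniq :=
  rewrite /= ?inE ?negb_or ?andbT; repeat (apply/andP; split); solve_neq.

Ltac solve_or :=
  first [solve_adj | apply/orP; left; solve_adj | apply/orP; right; solve_or].

Ltac solve_path :=
  rewrite /= ?andbT; repeat (apply/andP; split); solve [done | solve_adj].

Ltac solve_minor := first [solve_adj | solve_uniq | solve_path | solve [rewrite /=; solve_or]].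

(** * Vertices with twins *)

Section Combinatorics.
Variables (R : realType) (G : sgraph) (planarG : planar R G).
Implicit Types (v w x y z : G) (s : seq G).

Lemma no_K33 a b c x y z : a != b -> a != c -> b != c ->
  x != y -> x != z -> y != z -> adj a x -> adj a y -> adj a z ->
  adj b x -> adj b y -> adj b z -> adj c x -> adj c y -> adj c z -> False.
Proof.
move=> *; apply: (@no_K33_minor R G planarG a b c x [::] y [::] z [::]);
  solve_minor.
Qed.

Lemma no_K5 a b c d x : adj a b -> adj a c -> adj a d -> adj a x -> adj b c ->
  adj b d -> adj b x -> adj c d -> adj c x -> adj d x -> False.
Proof.
move=> *; apply: (@no_K5_minor R G planarG a b c d x [::]); solve_minor.
Qed.

Lemma in_nbrs v w : (w \in nbrs v) = adj v w.
Proof. by rewrite !inE /= andbT. Qed.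

Lemma in_common_nbrs s v : (v \in common_nbrs s) = all (fun u => adj u v) s.
Proof. by rewrite inE. Qed.

Section OneNotInA.
Variables (n : nat) (n3 : 3 <= n).
Hypothesis A1 : forall v s, uniq s -> size s = n -> all (fun u => adj u v) s ->
  exists2 w, w != v & all (fun u => adj u w) s.

Lemma three_common_nbrs v w1 w2 s : 3 <= size s -> uniq s ->
  all (fun u => adj u v) s -> all (fun u => adj u w1) s ->
  all (fun u => adj u w2) s -> v != w1 -> v != w2 -> w1 != w2 -> False.
Proof.
case: s => [|a [|b [|c s]]] //= _; rewrite !inE !negb_or.
move=> /and4P[/and3P[ab ac _] /andP[bc _] _ _].
move=> /and4P[? ? ? _] /and4P[? ? ? _] /and4P[? ? ? _] *.
by apply: (@no_K33 a b c v w1 w2).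
Qed.

(** Replacing one of the chosen neighbours by another neighbour [y] of [v] keeps n - 1 >= 3 of them.
    By K_{3,3} these have no common neighbour besides [v] and [w], so the second common neighbour is
    still [w], and [w] is adjacent to [y]. *)
Lemma dominated_vertex_gt3 : 3 < n -> forall v, n <= #|nbrs v| ->
  exists2 w, w != v & forall y, adj v y -> adj w y.
Proof.
move=> n4 v nv; pose s := take n (enum (nbrs v)).
have s_uniq : uniq s by rewrite take_uniq ?enum_uniq.
have s_size : size s = n by rewrite size_takel // -cardE.
have s_adj : all (fun u => adj u v) s.
  apply/allP => x /mem_take; rewrite mem_enum in_nbrs => vx.
  by rewrite adj_sym.
have [w wv ws] := A1 s_uniq s_size s_adj; exists w => // y vy.
case: (boolP (y \in s)) => [/(allP ws)|ys]; first by rewrite adj_sym.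
case: s s_uniq s_size s_adj ws ys => [|a t] /=; first by move=> _ n0; rewrite -n0 in n4.
move=> /andP[_ t_uniq] tn /andP[av tv] /andP[aw tw] yat.
have [||| w' w'v /= /andP[yw' tw']] := @A1 v (y :: t).
- by rewrite /= t_uniq andbT; move: yat; rewrite inE negb_or => /andP[].
- by [].
- by rewrite /= tv andbT adj_sym.
case: (eqVneq w w') => [->|ww']; first by rewrite adj_sym.
have t3 : 3 <= size t by rewrite -ltnS tn.
exfalso; apply: (three_common_nbrs t3 t_uniq tv tw tw') => //; by rewrite eq_sym.
Qed.

(* The configuration is the join of the edge [a b] with the path
   [wd, c, v, d, wc]; [b], [wc] and [wd] are three neighbours of [a]. *)
Lemma no_fan v a b c d wc wd : n = 3 ->
  adj v a -> adj v b -> adj v c -> adj v d ->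
  adj a b -> adj a c -> adj a d -> adj b c -> adj b d ->
  adj wc a -> adj wc b -> adj wc d -> adj wd a -> adj wd b -> adj wd c ->
  wc != v -> wd != v -> wc != c -> wd != d -> ~~ adj wc c -> ~~ adj wd d -> False.
Proof.
move=> n_3 va vb vc vd ab ac ad bc bd ca cb cd da db dc cv dv cc dd ncc ndd.
have wcd : wc != wd by solve_neq.
have [|||y ya /and4P[yb yc yd _]] := @A1 a [:: b; wc; wd].
- by solve_uniq.
- by rewrite n_3.
- by rewrite /= ca da adj_sym ab.
case: (eqVneq y v) => [yv|yv]; first by subst; apply: (@no_K5 a b v wc d); solve_adj.
have yc' : y != c by solve_neq.
have yd' : y != d by solve_neq.
(* The path [d], [wc], [y], [wd] is contracted: it meets [a], [b] and [v] through [d], and [c]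
   through [wd]. *)
apply: (@no_K5_minor R G planarG a b c v d [:: wc; y; wd]); solve_minor.
Qed.

(** K_{3,3} with [v], [wa], [wb] against [c], [d] and the path [a], [wc], [b], which [wa] meets in
    [b] and [wb] in [a]. *)
Lemma no_three_outer v a b c d wa wb wc :
  adj v a -> adj v b -> adj v c -> adj v d -> a != b -> a != c -> a != d ->
  b != c -> b != d -> c != d -> wa != v -> wb != v -> wc != v ->
  adj wa b -> adj wa c -> adj wa d -> adj wb a -> adj wb c -> adj wb d ->
  adj wc a -> adj wc b -> adj wc d -> ~~ adj wa a -> ~~ adj wb b -> ~~ adj wc c ->
  wa != a -> wb != b -> wc != c -> False.
Proof.
move=> *.
have ? : wa != wb by solve_neq.
have ? : wa != wc by solve_neq.
have ? : wb != wc by solve_neq.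
apply: (@no_K33_minor R G planarG v wa wb c [::] d [::] a [:: wc; b]); solve_minor.
Qed.

(** If [wd] misses a neighbour [d] of [v], each of the four triples in [a], [b], [c], [d] has a
    second common neighbour, which cannot be adjacent to the fourth vertex because of K_{3,3}. It
    may however be that fourth vertex. *)
Lemma dominated_vertex_eq3 : n = 3 -> forall v, n <= #|nbrs v| ->
  exists2 w, w != v & forall y, adj v y -> adj w y.
Proof.
move=> n_3 v nv.
have A1' x a b c : adj x a -> adj x b -> adj x c -> a != b -> a != c -> b != c ->
    exists w, [/\ w != x, adj w a, adj w b & adj w c].
  move=> xa xb xc ab ac bc; have [|||w wx] := @A1 x [:: a; b; c].
  - by solve_uniq.
  - by rewrite n_3.
  - by rewrite /= !(adj_sym _ x) xa xb xc.
  by move=> /= /and4P[wa wb wc _]; exists w; split=> //; rewrite adj_sym.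
have /card_gt2P[a [b [c [[]]]]] : 2 < #|nbrs v| by rewrite -n_3.
rewrite !in_nbrs => va vb vc [ab bc ca]; rewrite eq_sym in ca.
have [wd [wdv da db dc]] := A1' _ _ _ _ va vb vc ab ca bc.
case: (boolP [forall y, adj v y ==> adj wd y]) => [/forallP H|].
  by exists wd => // y vy; have := H y; rewrite vy.
rewrite negb_forall => /existsP[d]; rewrite negb_imply => /andP[vd dd]; exfalso.
have ad : a != d by solve_neq.
have bd : b != d by solve_neq.
have cd : c != d by solve_neq.
have [wc [wcv ca' cb cd']] := A1' _ _ _ _ va vb vd ab ad bd.
have [wb [wbv ba' bc' bd']] := A1' _ _ _ _ va vc vd ca ad cd.
have [wa [wav ab' ac' ad']] := A1' _ _ _ _ vb vc vd bc bd cd.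
have cc : ~~ adj wc c.
  apply/negP => wcc; have ? : wc != wd by solve_neq.
  apply: (@no_K33 v wc wd a b c); solve_minor.
have bb : ~~ adj wb b.
  apply/negP => wbb; have ? : wb != wd by solve_neq.
  apply: (@no_K33 v wb wd a b c); solve_minor.
have aa : ~~ adj wa a.
  apply/negP => waa; have ? : wa != wd by solve_neq.
  apply: (@no_K33 v wa wd a b c); solve_minor.
(* If three of the second neighbours lie outside the quadruple, [no_three_outer] applies. If three
   coincide with the missing vertex, the quadruple is complete and forms K_5 with [v]. In the case
   of two and two there is a fan. *)
case: (eqVneq wa a) => ea; case: (eqVneq wb b) => eb; case: (eqVneq wc c) => ec;
  case: (eqVneq wd d) => ed;
  try subst wa; try subst wb; try subst wc; try subst wd;
  try by [apply: (@no_three_outer v a b c d wa wb wc); solve_minor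
         |apply: (@no_three_outer v a b d c wa wb wd); solve_minor
         |apply: (@no_three_outer v a c d b wa wc wd); solve_minor
         |apply: (@no_three_outer v b c d a wb wc wd); solve_minor
         |apply: (@no_K5 v a b c d); solve_adj
         |apply: (@no_fan v a b c d wc wd); solve_minor
         |apply: (@no_fan v a c b d wb wd); solve_minor
         |apply: (@no_fan v a d b c wb wc); solve_minor
         |apply: (@no_fan v b c a d wa wd); solve_minor
         |apply: (@no_fan v b d a c wa wc); solve_minor
         |apply: (@no_fan v c d a b wa wb); solve_minor].
Qed.

(** The dominating vertex [w] has degree at least n as well, hence is dominated by some [w']. If
    [w'] were not [v], then [v], [w], [w'] would share the at least three neighbours of [v]. *)
Lemma twin_from_A1 : twin_from n G.
Proof.
have dom v : n <= #|nbrs v| -> exists2 w, w != v & forall y, adj v y -> adj w y.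
  case: (eqVneq n 3) => [/dominated_vertex_eq3|n_3]; first exact.
  by apply: dominated_vertex_gt3; rewrite ltn_neqAle eq_sym n_3.
move=> v nv; have [w wv vw] := dom v nv; exists w => //.
have sub_vw : nbrs v \subset nbrs w by apply/fintype.subsetP => y; rewrite !in_nbrs; exact: vw.
have [w' w'w ww'] := dom w (leq_trans nv (subset_leq_card sub_vw)).
case: (eqVneq v w') => [vw'|vw'].
  by apply/setP => y; rewrite !in_nbrs; apply/idP/idP => [/ww'|/vw //]; rewrite vw'.
exfalso; apply: (@three_common_nbrs v w w' (enum (nbrs v))).
- by rewrite -cardE; apply: leq_trans nv.
- exact: enum_uniq.
- by apply/allP => y; rewrite mem_enum in_nbrs adj_sym.
- by apply/allP => y; rewrite mem_enum in_nbrs => /vw; rewrite adj_sym.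
- by apply/allP => y; rewrite mem_enum in_nbrs => /vw/ww'; rewrite adj_sym.
- by rewrite eq_sym.
- by [].
- by rewrite eq_sym.
Qed.
End OneNotInA.
End Combinatorics.

(** * Graphs in which any three vertices have a common neighbour *)

(* The triangle [b, c, d] with a vertex stacked on each side, all of it in the
   neighbourhood of [x]; [tb] is the vertex opposite to [b]. *)
Record sun (G : sgraph) (x b c d tb tc td : G) : Prop := Sun {
  sun_x : [/\ adj x b, adj x c & adj x d];
  sun_xt : [/\ adj x tb, adj x tc & adj x td];
  sun_tri : [/\ adj b c, adj b d & adj c d];
  sun_tb : [/\ adj tb c, adj tb d, ~~ adj tb b & tb != b];
  sun_tc : [/\ adj tc b, adj tc d, ~~ adj tc c & tc != c];
  sun_td : [/\ adj td b, adj td c, ~~ adj td d & td != d] }.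

Lemma sun_rot (G : sgraph) (x b c d tb tc td : G) :
  sun x b c d tb tc td -> sun x c d b tc td tb.
Proof.
case=> [[? ? ?] [? ? ?] [? ? ?] [? ? ? ?] [? ? ? ?] [? ? ? ?]].
by split; split=> //; rewrite adj_sym.
Qed.

Lemma sun_swap (G : sgraph) (x b c d tb tc td : G) :
  sun x b c d tb tc td -> sun x c b d tc tb td.
Proof.
case=> [[? ? ?] [? ? ?] [? ? ?] [? ? ? ?] [? ? ? ?] [? ? ? ?]].
by split; split=> //; rewrite adj_sym.
Qed.

Section Triples.
Variables (R : realType) (G : sgraph) (planarG : planar R G).
Implicit Types (a b c d h u v w x y z t : G) (s : seq G).
Let K33 := no_K33_minor planarG.
Let K5 := no_K5_minor planarG.

(** * The neighbourhood of a vertex in which any two vertices have a common neighbour *)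

Section Link.
Variable x : G.
Hypothesis link : forall y z, adj x y -> adj x z -> y != z ->
  exists v, [/\ adj x v, adj v y & adj v z].

(** The opposite vertices [h] and [u] are joined through [w] and through [p]. Common neighbours of
    two opposite sides, linked by a further one, give a third route, and [x] completes K_{3,3}. *)
Lemma link_no_C4 h w u p : adj x h -> adj x w -> adj x u -> adj x p ->
  adj h w -> adj w u -> adj u p -> adj p h -> h != u -> w != p ->
  ~~ adj h u -> ~~ adj w p -> False.
Proof.
move=> xh xw xu xp hw wu up ph hu wp nhu nwp.
have [|t1 [xt1 t1h t1w]] := link xh xw; first solve_neq.
have [|t3 [xt3 t3u t3p]] := link xu xp; first solve_neq.
have t1u : ~~ adj t1 u.
  apply/negP => ?; apply: (@K33 x h u w [::] p [::] t1 [::]); solve_minor.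
have t1p : ~~ adj t1 p.
  apply/negP => ?; apply: (@K33 x w p h [::] u [::] t1 [::]); solve_minor.
have t3h : ~~ adj t3 h.
  apply/negP => ?; apply: (@K33 x h u w [::] p [::] t3 [::]); solve_minor.
have t3w : ~~ adj t3 w.
  apply/negP => ?; apply: (@K33 x w p h [::] u [::] t3 [::]); solve_minor.
have [|s [xs st1 st3]] := link xt1 xt3; first solve_neq.
have ? : t1 != t3 by solve_neq.
apply: (@K33 x h u w [::] p [::] t1 [:: s; t3]); solve_minor.
Qed.

(** Same scheme for [w] and [z]: the routes [h] and [u], [q] run around the cycle, and [t1], [s],
    [t2] is the third. *)
Lemma link_no_C5 h z q u w :
  adj x h -> adj x z -> adj x q -> adj x u -> adj x w ->
  adj h z -> adj z q -> adj q u -> adj u w -> adj w h ->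
  ~~ adj h q -> ~~ adj h u -> ~~ adj z u -> ~~ adj z w -> ~~ adj q w -> False.
Proof.
move=> xh xz xq xu xw hz zq qu uw wh hq hu zu zw qw.
have [|t1 [xt1 t1h t1w]] := link xh xw; first solve_neq.
have [|t2 [xt2 t2z t2q]] := link xz xq; first solve_neq.
have ? : w != z by solve_neq.
have ? : h != q by solve_neq.
have ? : h != u by solve_neq.
have t1z : ~~ adj t1 z.
  apply/negP => ?; apply: (@K33 x w z t1 [::] h [::] u [:: q]); solve_minor.
have t1q : ~~ adj t1 q.
  apply/negP => ?; apply: (@K33 x h q t1 [::] z [::] w [:: u]); solve_minor.
have t1u : ~~ adj t1 u.
  apply/negP => ?; apply: (@K33 x h u t1 [::] w [::] z [:: q]); solve_minor.
have t2h : ~~ adj t2 h.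
  apply/negP => ?; apply: (@K33 x h q t2 [::] z [::] w [:: u]); solve_minor.
have t2w : ~~ adj t2 w.
  apply/negP => ?; apply: (@K33 x w z t2 [::] h [::] u [:: q]); solve_minor.
have ? : t1 != t2 by solve_neq.
have [|s [xs st1 st2]] := link xt1 xt2; first by [].
apply: (@K33 x w z h [::] u [:: q] t1 [:: s; t2]); solve_minor.
Qed.

Hypothesis no_hub : forall h, adj x h ->
  exists u, [/\ adj x u, u != h & ~~ adj h u].

(** Without such a pair, [w] and a vertex [z] not adjacent to it are joined by three disjoint
    routes: [h], [p], then [u], [q], and a common neighbour [y]. With [x] this is K_{3,3}. The
    possible adjacencies that would spoil the routes produce an excluded diamond or an induced cycle
    of length 4 or 5. *)
Lemma link_diamond : (exists h, adj x h) -> exists h u w w',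
  [/\ adj x h, adj x u, adj x w & adj x w'] /\
  [/\ h != u, ~~ adj h u & adj w w'] /\
  [/\ adj w h, adj w u, adj w' h & adj w' u].
Proof.
move=> [h xh]; apply: contrapT => nd.
have ND a b c d : adj x a -> adj x b -> adj x c -> adj x d -> a != b ->
    ~~ adj a b -> adj c d -> adj c a -> adj c b -> adj d a -> adj d b -> False.
  by move=> *; apply: nd; exists a, b, c, d.
(* Two common neighbours of a non-adjacent pair form a diamond with it if adjacent, and an induced
   4-cycle otherwise. *)
have C4 a b c d : adj x a -> adj x b -> adj x c -> adj x d -> a != b ->
    ~~ adj a b -> c != d -> adj c a -> adj c b -> adj d a -> adj d b -> False.
  move=> xa xb xc xd ab nab cd ca cb da db.
  case: (boolP (adj c d)) => [|ncd]; first by move=> ?; apply: (@ND a b c d).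
  apply: (@link_no_C4 a c b d); solve_minor.
have [u [xu uh hu]] := no_hub xh; rewrite eq_sym in uh.
have [w [xw wh wu]] := link xh xu uh.
have [z [xz zw wz]] := no_hub xw.
have zh : z != h by solve_neq.
have zu : z != u by solve_neq.
have [p [xp ph pz]] : exists v, [/\ adj x v, adj v h & adj v z].
  by apply: link => //; rewrite eq_sym.
have [q [xq qu qz]] : exists v, [/\ adj x v, adj v u & adj v z].
  by apply: link => //; rewrite eq_sym.
(* The configuration is symmetric under exchanging [h] and [u]. *)
have case1 h' u' q' : adj x h' -> adj x u' -> adj x q' -> h' != u' ->
    ~~ adj h' u' -> adj w h' -> adj w u' -> adj q' u' -> adj q' z ->
    z != h' -> z != u' -> ~~ adj z h'.
  move=> xh' xu' xq' h'u' nh'u' wh' wu' qu' qz' zh' zu'; apply/negP => zadj.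
  have zwu : ~~ adj z u'.
    by apply/negP => ?; apply: (@C4 h' u' w z) => //; solve_neq.
  have qh : ~~ adj q' h'.
    have ? : q' != w by solve_neq.
    apply/negP => ?; apply: (@C4 h' u' w q') => //; solve_neq.
  case: (boolP (adj q' w)) => qw.
    have ? : q' != h' by solve_neq.
    apply: (@C4 z w h' q'); solve_minor.
  apply: (@link_no_C5 h' z q' u' w); solve_minor.
have uh' : u != h by rewrite eq_sym.
have hu' : ~~ adj u h by rewrite adj_sym.
have nzh : ~~ adj z h by apply: (case1 h u q).
have nzu : ~~ adj z u by apply: (case1 u h p).
have npu : ~~ adj p u.
  have ? : p != w by solve_neq.
  by apply/negP => ?; apply: (@C4 h u w p) => //; solve_neq.
have nqh : ~~ adj q h.
  have ? : q != w by solve_neq.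
  by apply/negP => ?; apply: (@C4 h u w q) => //; solve_neq.
have case2 h' u' p' q' : adj x h' -> adj x u' -> adj x q' -> adj x p' ->
    h' != u' -> ~~ adj h' u' -> adj w h' -> adj w u' -> adj q' u' -> adj q' z ->
    adj p' h' -> adj p' z -> ~~ adj p' u' -> ~~ adj z u' -> ~~ adj p' w.
  move=> xh' xu' xq' xp' h'u' nh'u' wh' wu' qu' qz' ph' pz' npu' nzu'.
  apply/negP => pw; have pq : p' != q' by solve_neq.
  have wz' : w != z by solve_neq.
  case: (boolP (adj q' w)) => qw; first by apply: (@C4 w z p' q').
  case: (boolP (adj p' q')) => npq.
    apply: (@link_no_C4 p' q' u' w); solve_minor.
  apply: (@link_no_C5 p' z q' u' w); solve_minor.
have npw : ~~ adj p w by apply: (case2 h u p q).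
have nqw : ~~ adj q w by apply: (case2 u h q p).
have wz' : w != z by solve_neq.
have [y [xy yw yz]] := link xw xz wz'.
have ? : p != q by solve_neq.
apply: (@K33 x w z y [::] h [:: p] u [:: q]); solve_minor.
Qed.

Lemma link_sun : (exists h, adj x h) -> exists b c d tb tc td, sun x b c d tb tc td.
Proof.
move=> /link_diamond[h [u [w [w' [[xh xu xw xw'] [[hu nhu ww'] [wh wu w'h w'u]]]]]]].
(* If [z] missed both [w1] and [w2], a route from [h] to [u] via [z] would avoid them and be the
   third one besides [w1] and [w2]. *)
have far (w1 w2 z : G) : adj x w1 -> adj x w2 -> adj x z -> adj w1 w2 ->
    adj w1 h -> adj w1 u -> adj w2 h -> adj w2 u -> z != w1 -> ~~ adj w1 z ->
    adj z w2.
  move=> xw1 xw2 xz w12 w1h w1u w2h w2u zw1 nw1z.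
  case: (boolP (adj z w2)) => // nzw2; exfalso.
  have [|p [xp ph pz]] := link xh xz; first solve_neq.
  have [|q [xq qu qz]] := link xu xz; first solve_neq.
  case: (eqVneq p q) => [pq|pq].
    subst q; apply: (@K33 x h u w1 [::] w2 [::] p [::]); solve_minor.
  case: (boolP (adj p u)) => pu.
    apply: (@K33 x h u w1 [::] w2 [::] p [::]); solve_minor.
  case: (boolP (adj q h)) => qh.
    apply: (@K33 x h u w1 [::] w2 [::] q [::]); solve_minor.
  apply: (@K33 x h u w1 [::] w2 [::] p [:: z; q]); solve_minor.
have [z1 [xz1 z1w nwz1]] := no_hub xw.
have [z2 [xz2 z2w' nw'z2]] := no_hub xw'.
have z1w' : adj z1 w' by apply: (far w w').
have z2w : adj z2 w by apply: (far w' w) => //; rewrite adj_sym.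
have z12 : z1 != z2 by solve_neq.
(* If [t] is neither [h] nor [u], then [h], [u] and [z1], [t], [z2] are three routes from [w] to
   [w']. So [t] is [h] or [u]; it completes the triangle of the sun, and the other of the two is the
   tip opposite to it. *)
have [t [xt tz1 tz2]] := link xz1 xz2 z12.
case: (eqVneq t h) => [th|th].
  subst t; exists h, w, w', u, z1, z2.
  by split; split=> //; try solve_adj; try solve_neq; rewrite adj_sym.
case: (eqVneq t u) => [tu|tu].
  subst t; exists u, w, w', h, z1, z2.
  by split; split=> //; try solve_adj; try solve_neq; rewrite adj_sym.
exfalso; apply: (@K33 x w w' h [::] u [::] z1 [:: t; z2]); solve_minor.
Qed.

Lemma sun_tips b c d tb tc td : sun x b c d tb tc td ->
  [/\ ~~ adj tb tc, ~~ adj tb td & ~~ adj tc td].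
Proof.
case=> [[? ? ?] [? ? ?] [? ? ?] [? ? ? ?] [? ? ? ?] [? ? ? ?]].
split; apply/negP => ?.
- apply: (@K5 x b c d tb [:: tc]); solve_minor.
- apply: (@K5 x b c d tb [:: td]); solve_minor.
- apply: (@K5 x b c d tc [:: td]); solve_minor.
Qed.

(** Both [b] and [tb] are adjacent to [c], [d] and [x]. Through [v], and [tc] if [v] misses [b],
    there is a third route between them avoiding [c] and [d]. *)
Lemma sun_outer b c d tb tc td v : sun x b c d tb tc td -> adj x v ->
  v \notin [:: b; c; d; tb; tc; td] -> ~~ adj v c -> ~~ adj v d -> False.
Proof.
move=> S xv; have [nbc nbd ncd] := sun_tips S.
case: S => [[? ? ?] [? ? ?] [? ? ?] [? ? ? ?] [? ? ? ?] [? ? ? ?]].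
rewrite !inE !negb_or => /and5P[vb vc vd vtb /andP[vtc vtd]] nvc nvd.
have [||q [xq qv qtb]] := @link v tb xv; try by [].
have [||r [xr rv rtc]] := @link v tc xv; try by [].
case: (boolP (adj v b)) => [?|nvb].
  apply: (@K33 x b tb c [::] d [::] q [:: v]); solve_minor.
have ? : q != c by solve_neq.
have ? : q != d by solve_neq.
case: (eqVneq q r) => qr.
  subst r; apply: (@K33 x b tb c [::] d [::] q [:: tc]); solve_minor.
case: (boolP (adj q tc)) => ?.
  apply: (@K33 x b tb c [::] d [::] q [:: tc]); solve_minor.
apply: (@K33 x b tb c [::] d [::] q [:: v; r; tc]); solve_minor.
Qed.

(** A further vertex adjacent to two corners of the triangle would give K_{3,3} with [x], the third
    corner and the tip on that side. So it misses two corners, and by symmetry [sun_outer]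
    applies. *)
Lemma sun_exact b c d tb tc td v : sun x b c d tb tc td -> adj x v ->
  v \in [:: b; c; d; tb; tc; td].
Proof.
move=> S xv; apply/negPn/negP => vS; have := S.
case=> [[? ? ?] [? ? ?] [? ? ?] [? ? ? ?] [? ? ? ?] [? ? ? ?]].
have vS' := vS; move: vS'; rewrite !inE !negb_or.
move=> /and5P[vb vc vd vtb /andP[vtc vtd]].
have vbc : ~~ (adj v b && adj v c).
  apply/negP => /andP[? ?].
  apply: (@K33 x b c d [::] td [::] v [::]); solve_minor.
have vbd : ~~ (adj v b && adj v d).
  apply/negP => /andP[? ?].
  apply: (@K33 x b d c [::] tc [::] v [::]); solve_minor.
have vcd : ~~ (adj v c && adj v d).
  apply/negP => /andP[? ?].
  apply: (@K33 x c d b [::] tb [::] v [::]); solve_minor.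
case: (boolP (adj v b)) => ab.
  by rewrite ab /= in vbc vbd; apply: (sun_outer S xv).
case: (boolP (adj v c)) => ac.
  rewrite ac /= in vcd; apply: (sun_outer (sun_swap S) xv) => //; rewrite !inE !negb_or.
  by rewrite vb vc vd vtb vtc vtd.
apply: (sun_outer (sun_rot (sun_rot S)) xv) => //; rewrite !inE !negb_or.
by rewrite vb vc vd vtb vtc vtd.
Qed.
End Link.
End Triples.

(** * Recognition of S_5 and S_7 *)

Lemma isomorphic_of (G S : sgraph) (g : S -> G) : injective g ->
  (forall v, exists k, g k = v) -> (forall k l, adj (g k) (g l) = adj k l) ->
  isomorphic G S.
Proof.
move=> g_inj /choice[f fK] g_adj; exists f; split.
  by exists g => // k; apply: g_inj; rewrite fK.
by move=> u v; rewrite -g_adj !fK.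
Qed.

Definition K4plus_pos (s : seq (seq nat)) (k : K4plus s) : nat :=
  match k with inl i => i | inr j => 4 + j end.

Lemma isomorphic_K4plus (G : sgraph) (s : seq (seq nat)) (v0 : G) (vs : seq G) :
  uniq vs -> size vs = 4 + size s -> (forall v, v \in vs) ->
  (forall k l : K4plus s,
     adj (nth v0 vs (K4plus_pos k)) (nth v0 vs (K4plus_pos l)) = adj k l) ->
  isomorphic G (K4plus s).
Proof.
move=> vs_uniq vs_size vs_all vs_adj.
have pos_lt (k : K4plus s) : K4plus_pos k < size vs.
  rewrite vs_size; case: k => [i|j]; last by rewrite ltn_add2l.
  exact: leq_trans (ltn_ord i) (leq_addr _ _).
apply: (isomorphic_of (g := fun k => nth v0 vs (K4plus_pos k))) => //.
  move=> k l /eqP; rewrite nth_uniq // => /eqP; case: k l => [i|j] [i'|j'] /=.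
  - by move/ord_inj->.
  - by move=> E; have := ltn_ord i; rewrite E.
  - by move=> E; have := ltn_ord i'; rewrite -E.
  - by move/addnI/ord_inj->.
move=> v; have := vs_all v; rewrite -index_mem vs_size => iv.
case: (ltnP (index v vs) 4) => h.
  by exists (inl (Ordinal h)); rewrite /= nth_index.
have h' : index v vs - 4 < size s by rewrite ltn_subLR.
by exists (inr (Ordinal h')); rewrite /= subnKC // nth_index.
Qed.

Ltac solve_nadj :=
  first [by rewrite adj_irr | apply/negbTE; assumption
        | rewrite adj_sym; apply/negbTE; assumption].

Ltac compute_adj :=
  match goal with |- adj ?u ?v = _ =>
    first [have -> : adj u v = true by solve_adj
          | have -> : adj u v = false by solve_nadj]; reflexivity
  end.

Section Triples.
Variables (R : realType) (G : sgraph) (planarG : planar R G).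
Implicit Types (a b c d h u v w x y z t : G) (s : seq G).
Let K33 := no_K33_minor planarG.
Let K5 := no_K5_minor planarG.
Hypothesis triple : forall y z w, y != z -> y != w -> z != w ->
  exists v, [/\ adj v y, adj v z & adj v w].

Lemma triple_link x y z : adj x y -> adj x z -> y != z ->
  exists v, [/\ adj x v, adj v y & adj v z].
Proof.
move=> xy xz yz; have [|||v [vx vy vz]] := @triple x y z; try solve_neq.
by exists v; rewrite adj_sym.
Qed.

(** A common neighbour of [x], [y] and the tip [tb] lies in the sun, where only [c] and [d] are
    adjacent to [tb]. *)
Lemma sun_far_pair x b c d tb tc td y : sun x b c d tb tc td ->
  y != x -> ~~ adj y x -> adj y c \/ adj y d.
Proof.
move=> S yx nyx; have [nbc nbd ncd] := sun_tips planarG S; have := S.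
case=> [[? ? ?] [? ? ?] [? ? ?] [? ? ? ?] [? ? ? ?] [? ? ? ?]].
have [|||v [vx vy vtb]] := @triple x y tb; try solve_neq.
have := sun_exact planarG (@triple_link x) S (v := v).
rewrite adj_sym => /(_ vx); rewrite !inE => /or4P[/eqP?|/eqP?|/eqP?|/or3P[]/eqP?]; subst v.
- by exfalso; adj_absurd.
- by left; rewrite adj_sym.
- by right; rewrite adj_sym.
- by exfalso; adj_absurd.
- by exfalso; adj_absurd.
- by exfalso; adj_absurd.
Qed.

(** Inside the sun only [d] is adjacent to both [tb] and [tc]. If [y] misses [d], the common
    neighbour of [y], [tb], [tc] lies outside N(x), is adjacent to two corners by [sun_far_pair],
    and yields K_{3,3}. *)
Lemma sun_far_adj x b c d tb tc td y : sun x b c d tb tc td ->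
  y != x -> ~~ adj y x -> adj y d.
Proof.
move=> S yx nyx; case: (boolP (adj y d)) => // nyd; exfalso.
have [nbc nbd ncd] := sun_tips planarG S; have := S.
case=> [[? ? ?] [? ? ?] [? ? ?] [? ? ? ?] [? ? ? ?] [? ? ? ?]].
have [|||w [wy wtb wtc]] := @triple y tb tc; try solve_neq.
have nwx : ~~ adj w x.
  apply/negP => wx; have := sun_exact planarG (@triple_link x) S (v := w).
  rewrite adj_sym => /(_ wx); rewrite !inE.
  by move=> /or4P[/eqP?|/eqP?|/eqP?|/or3P[]/eqP?]; subst w; adj_absurd.
have wx : w != x by solve_neq.
have ? : w != d by solve_neq.
case: (sun_far_pair S wx nwx) => [wc|wd].
  case: (sun_far_pair (sun_swap S) wx nwx) => [wb|wd].
    apply: (@K33 x w d b [::] c [::] tb [::]); solve_minor.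
  apply: (@K33 x w b c [::] d [::] tc [::]); solve_minor.
case: (sun_far_pair (sun_rot (sun_rot S)) wx nwx) => [wb|wc].
  apply: (@K33 x w c b [::] d [::] tb [::]); solve_minor.
apply: (@K33 x w b c [::] d [::] tc [::]); solve_minor.
Qed.

(** A vertex not adjacent to [x] is adjacent to all three corners, and K_{3,3} allows at most one
    such vertex: none gives S_5, one gives S_7. *)
Lemma sun_isomorphic x b c d tb tc td : sun x b c d tb tc td ->
  isomorphic G S5 \/ isomorphic G S7.
Proof.
move=> S; have [nbc nbd ncd] := sun_tips planarG S; have := S.
case=> [[? ? ?] [? ? ?] [? ? ?] [? ? ? ?] [? ? ? ?] [? ? ? ?]].
have exact v : adj x v -> v \in [:: b; c; d; tb; tc; td].
  exact: (sun_exact planarG (@triple_link x) S).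
have far v : v != x -> ~~ adj v x -> [/\ adj v b, adj v c & adj v d].
  move=> vx nvx; split; last exact: (sun_far_adj S).
    exact: (sun_far_adj (sun_rot S)).
  exact: (sun_far_adj (sun_rot (sun_rot S))).
case: (pselect (exists y, y != x /\ ~~ adj y x)) => [[y [yx nyx]]|near]; last first.
  (* The order is forced by [S5]: [x], [b], [c], [d] are 0 to 3, and [td], [tc], [tb] have the
     neighbours 012, 013, 023. *)
  left; apply: (@isomorphic_K4plus _ _ x [:: x; b; c; d; td; tc; tb]) => //.
  - solve_uniq.
  - move=> v; rewrite inE; case: (eqVneq v x) => //= vx.
    have : adj x v.
      by rewrite adj_sym; apply/negPn/negP => nvx; apply: near; exists v.
    by move/exact; rewrite !inE => /or4P[->|->|->|/or3P[]->]; rewrite ?orbT.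
  move=> [[[|[|[|[|k]]]] //= kP]|[[|[|[|k]]] //= kP]];
  move=> [[[|[|[|[|l]]]] //= lP]|[[|[|[|l]]] //= lP]]; compute_adj.
right.
have [yb yc yd] := far y yx nyx.
have nytb : ~~ adj y tb.
  apply/negP => ?; apply: (@K5 x b c d y [:: tb]); solve_minor.
have nytc : ~~ adj y tc.
  apply/negP => ?; apply: (@K5 x b c d y [:: tc]); solve_minor.
have nytd : ~~ adj y td.
  apply/negP => ?; apply: (@K5 x b c d y [:: td]); solve_minor.
apply: (@isomorphic_K4plus _ _ x [:: x; b; c; d; td; tc; tb; y]) => //.
- solve_uniq.
- move=> v; rewrite inE; case: (eqVneq v x) => //= vx.
  case: (boolP (adj x v)) => [/exact|].
    by rewrite !inE => /or4P[->|->|->|/or3P[]->]; rewrite ?orbT.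
  rewrite adj_sym => nvx; have [vb vc vd] := far v vx nvx.
  case: (eqVneq v y) => [->|vy]; first by rewrite !inE eqxx !orbT.
  exfalso; apply: (@K33 x v y b [::] c [::] d [::]); solve_minor.
move=> [[[|[|[|[|k]]]] //= kP]|[[|[|[|[|k]]]] //= kP]];
move=> [[[|[|[|[|l]]]] //= lP]|[[|[|[|[|l]]]] //= lP]]; compute_adj.
Qed.
End Triples.

(** * Linear forests as spanning subgraphs of a path *)

Section LinearForest.
Variable H : sgraph.
Implicit Types (u v a b c : H) (p s : seq H).
Hypothesis degree_le2 : forall v a b c, adj v a -> adj v b -> adj v c ->
  a != b -> a != c -> b != c -> False.
Hypothesis acyclic : forall v p, path (@adj H) v p -> uniq (v :: p) ->
  2 <= size p -> adj (last v p) v -> False.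

Definition consecutive s u v := exists p p', s = p ++ u :: v :: p'.

Lemma consecutive_catl s s' u v : consecutive s u v -> consecutive (s ++ s') u v.
Proof. by case=> p [p' ->]; exists p, (p' ++ s'); rewrite -catA. Qed.

Lemma consecutive_catr s s' u v : consecutive s u v -> consecutive (s' ++ s) u v.
Proof. by case=> p [p' ->]; exists (s' ++ p), p'; rewrite catA. Qed.

Lemma longest_path (A : pred H) : (exists v, A v) -> exists x p,
  [/\ path (@adj H) x p, uniq (x :: p), all A (x :: p),
      forall v, A v -> adj v x -> v \in x :: p &
      forall v, A v -> adj (last x p) v -> v \in x :: p].
Proof.
move=> [v0 Av0].
pose P n := `[< exists x p,
  [/\ path (@adj H) x p, uniq (x :: p), all A (x :: p) & size p = n] >].
have P0 : exists n, P n.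
  by exists 0; apply/asboolP; exists v0, [::]; rewrite /= Av0.
have Pmax n : P n -> n <= #|H|.
  move=> /asboolP[x [p [_ U _ <-]]].
  apply: leq_trans (leqnSn (size p)) _; rewrite -[(size p).+1]/(size (x :: p)).
  by rewrite -(card_uniqP U) max_card.
case: (ex_maxnP P0 Pmax) => n /asboolP[x [p [xp U Ap pn]]] maxn.
exists x, p; split=> // v Av vx; apply/negPn/negP => vN.
  have : P n.+1.
    apply/asboolP; exists v, (x :: p); split.
    - by rewrite /= vx.
    - by rewrite cons_uniq vN.
    - by rewrite /= Av.
    - by rewrite /= pn.
  by move/maxn; rewrite ltnn.
have : P n.+1.
  apply/asboolP; exists x, (rcons p v); split.
  - by rewrite rcons_path xp.
  - by rewrite -rcons_cons rcons_uniq vN.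
  - by rewrite -rcons_cons all_rcons Av.
  - by rewrite size_rcons pn.
by move/maxn; rewrite ltnn.
Qed.

(** A chord would close a cycle, an edge leaving an inner vertex would give it a third neighbour,
    and an edge leaving an end contradicts maximality. *)
Lemma maximal_path_component (A : pred H) x p : path (@adj H) x p ->
  uniq (x :: p) -> (forall v, A v -> adj v x -> v \in x :: p) ->
  (forall v, A v -> adj (last x p) v -> v \in x :: p) ->
  forall u v, u \in x :: p -> A v -> adj u v ->
  consecutive (x :: p) u v \/ consecutive (x :: p) v u.
Proof.
move=> xp U xA lA u v us Av uv.
have sp : sorted (@adj H) (x :: p) by [].
have chord p1 p2 p3 a b : x :: p = p1 ++ a :: p2 ++ b :: p3 -> adj a b ->
    consecutive (x :: p) a b.
  move=> E ab; case: p2 E => [|c p2] E; first by exists p1, p3.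
  exfalso; have Es : x :: p = p1 ++ (a :: rcons (c :: p2) b) ++ p3.
    by rewrite E /= cat_rcons.
  have ap : path (@adj H) a (rcons (c :: p2) b).
    by move: sp; rewrite Es => /cat_sorted2[_ /cat_sorted2[]].
  have ua : uniq (a :: rcons (c :: p2) b).
    by move: U; rewrite Es cat_uniq => /and3P[_ _]; rewrite cat_uniq => /and3P[].
  by apply: (acyclic ap ua); rewrite ?size_rcons // last_rcons adj_sym.
have [q1 [q2 E]] : exists q1 q2, x :: p = q1 ++ u :: q2.
  by case/splitPr: us => q1 q2; exists q1, q2.
case: (boolP (v \in x :: p)) => [|vs].
  rewrite {1}E mem_cat inE => /or3P[vq1|/eqP vu|vq2].
  - right; case/splitPr: vq1 E => r1 r2 E; apply: (chord r1 r2 q2).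
      by rewrite E -catA.
    by rewrite adj_sym.
  - by rewrite vu adj_irr in uv.
  - left; case/splitPr: vq2 E => r1 r2 E; exact: (chord q1 r1 r2).
exfalso; case/lastP: q1 E => [|q1 a] E.
  have ux : x = u by case: E.
  have : adj v x by rewrite ux adj_sym.
  by move/(xA v Av); apply/negP.
case: q2 E => [|b q2] E.
  have lu : last x p = u by rewrite -(last_cons x x p) E last_cat.
  have : adj (last x p) v by rewrite lu.
  by move/(lA v Av); apply/negP.
move: sp; rewrite E cat_rcons => /cat_sorted2[_] /= /and3P[au ub _].
apply: (@degree_le2 u a b v) => //; first by rewrite adj_sym.
- move: U; rewrite E cat_rcons cat_uniq => /and3P[_ _] /=.
  by rewrite !inE !negb_or => /andP[/and3P[]].
- apply: contraNneq vs => <-; rewrite E mem_cat mem_rcons mem_head //.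
- by apply: contraNneq vs => <-; rewrite E mem_cat !inE eqxx !orbT.
Qed.

(** A longest path is split off and the induction continues on the other vertices of [A]; no edge
    inside [A] joins the two parts, so the orderings can be concatenated. *)
Lemma linear_ordering (A : pred H) : exists s, [/\ uniq s, s =i A &
  forall u v, A u -> A v -> adj u v -> consecutive s u v \/ consecutive s v u].
Proof.
have [n] := ubnP #|A|; elim: n A => // n IH A An.
case: (pselect (exists v, A v)) => [nA|eA]; last first.
  exists [::]; split=> //.
    by move=> v; rewrite inE; apply/esym/negbTE/negP => Av; apply: eA; exists v.
  by move=> u v Au; exfalso; apply: eA; exists u.
have [x [p [xp U Ap xA lA]]] := longest_path nA.
have comp := maximal_path_component xp U xA lA.
pose B := [pred v | A v && (v \notin x :: p)].
have [|s [sU sB sc]] := IH B.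
  move: An; rewrite ltnS; apply: leq_trans; apply: proper_card; apply/properP; split.
    by apply/fintype.subsetP => v; rewrite !inE => /andP[].
  by exists x; [case/andP: Ap|rewrite !inE eqxx andbF].
exists ((x :: p) ++ s); split.
- rewrite cat_uniq U sU andbT; apply/hasPn => v; rewrite sB.
  by rewrite !inE => /andP[].
- move=> v; rewrite mem_cat sB; case: (boolP (v \in x :: p)) => vs.
    by rewrite /= [v \in A](allP Ap v vs).
  by rewrite /= !inE vs andbT.
move=> u v Au Av uv.
case: (boolP (u \in x :: p)) => us.
  by case: (comp u v us Av uv) => ?; [left|right]; apply: consecutive_catl.
case: (boolP (v \in x :: p)) => vs.
  have vu : adj v u by rewrite adj_sym.
  by case: (comp v u vs Au vu) => ?; [right|left]; apply: consecutive_catl.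
have Bu : B u by rewrite /B /= Au.
have Bv : B v by rewrite /B /= Av.
by case: (sc u v Bu Bv uv) => ?; [left|right]; apply: consecutive_catr.
Qed.

Lemma consecutive_index s u v : uniq s -> consecutive s u v ->
  index v s = (index u s).+1.
Proof.
move=> U [p [p' E]]; move: U; rewrite E cat_uniq /= negb_or.
rewrite !inE !negb_or => /and3P[_ /and3P[up vp _] /and3P[/andP[uv _] _ _]].
rewrite !index_cat (negPf up) (negPf vp) /= !eqxx (negPf uv).
by rewrite addn0 addn1.
Qed.

Lemma linear_forest_spanning : is_spanning_subgraph H (path_graph #|H|).
Proof.
have [s [sU sA sc]] := linear_ordering predT.
have sH : size s = #|H| by rewrite -(card_uniqP sU); apply: eq_card.
have lt v : index v s < #|H| by rewrite -sH index_mem sA.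
exists (fun v => Ordinal (lt v) : path_graph #|H|); split.
  apply: inj_card_bij; last by rewrite card_ord.
  by move=> u v [E]; rewrite -(@nth_index _ u u s) ?E ?nth_index ?sA.
move=> u v uv; rewrite /= /path_rel /=.
by case: (sc u v isT isT uv) => /(consecutive_index sU)->; rewrite eqxx ?orbT.
Qed.
End LinearForest.

Section Induced.
Variables (G : sgraph) (P : pred G).

Definition induced_rel : rel {v : G | P v} := fun u v => adj (val u) (val v).

Lemma induced_sym : symmetric induced_rel.
Proof. by move=> u v; rewrite /induced_rel adj_sym. Qed.

Lemma induced_irr : irreflexive induced_rel.
Proof. by move=> u; rewrite /induced_rel adj_irr. Qed.

Definition induced : sgraph := SGraph induced_sym induced_irr.
End Induced.

(** * Hubs in the neighbourhood and the classes T_m *)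

Section Hub.
Variables (R : realType) (G : sgraph) (planarG : planar R G).
Implicit Types (a b c d h u v w x y z t f : G) (s : seq G).
Let K33 := no_K33_minor planarG.
Let K5 := no_K5_minor planarG.
Hypothesis triple : forall y z w, y != z -> y != w -> z != w ->
  exists v, [/\ adj v y, adj v z & adj v w].

Lemma two_hubs_degree x h v a b c : adj x h -> adj x v -> adj h v ->
  adj x a -> adj h a -> adj x b -> adj h b -> adj x c -> adj h c ->
  adj v a -> adj v b -> adj v c -> a != b -> a != c -> b != c -> False.
Proof. by move=> *; apply: (@no_K33 R G planarG x h v a b c) => //; solve_neq. Qed.

(** A cycle of common neighbours of [x] and [h] contracts to a triangle, which forms K_5 with the
    two hubs. *)
Lemma two_hubs_acyclic x h v p : adj x h ->
  (forall u, u \in v :: p -> adj x u /\ adj h u) ->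
  path (@adj G) v p -> uniq (v :: p) -> 2 <= size p -> adj (last v p) v -> False.
Proof.
move=> xh hubs; case: p hubs => [|c1 [|c2 p]] // hubs vp U _ lv.
have /and3P[vc1 c12 c2p] := vp; rewrite /= in lv.
have [xv hv] : adj x v /\ adj h v by apply: hubs; rewrite mem_head.
have [xc1 hc1] : adj x c1 /\ adj h c1 by apply: hubs; rewrite !inE eqxx orbT.
have [xc2 hc2] : adj x c2 /\ adj h c2 by apply: hubs; rewrite !inE eqxx !orbT.
apply: (@K5 x h v c1 c2 p) => //; try by rewrite /= ?xc2 ?hc2 ?c12.
- rewrite (cons_uniq x) (cons_uniq h) U andbT inE negb_or.
  apply/andP; split; last by apply/negP => /hubs[_]; rewrite adj_irr.
  by apply/andP; split; [solve_neq|apply/negP => /hubs[]; rewrite adj_irr].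
- by apply/hasP; exists (last c2 p); rewrite ?mem_last // adj_sym.
Qed.

Lemma two_hubs_class_T x h : adj x h ->
  (forall v, v != x -> v != h -> adj x v /\ adj h v) ->
  (exists v, v != x /\ v != h) -> exists2 m, 2 <= m & class_T m G.
Proof.
move=> xh hubs [v0 [v0x v0h]].
pose H := induced (fun v => (v != x) && (v != h)).
have Hx (v : H) : adj x (val v).
  by case: v => v /= /andP[vx vh]; case: (hubs v vx vh).
have Hh (v : H) : adj h (val v).
  by case: v => v /= /andP[vx vh]; case: (hubs v vx vh).
have noiso : no_isolated_vertex H.
  move=> v; have [|||w [wv wx wh]] := @triple (val v) x h.
  - by case: v => v /= /andP[].
  - by case: v => v /= /andP[].
  - solve_neq.
  have wP : (w != x) && (w != h) by apply/andP; split; solve_neq.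
  by exists (Sub w wP); rewrite /= /induced_rel SubK adj_sym.
pose v1 : H := Sub v0 (introT andP (conj v0x v0h)).
have H2 : 2 <= #|H|.
  have [w vw] := noiso v1; apply/card_gt1P; exists v1, w; split=> //.
  by apply: contraTneq vw => ->; rewrite adj_irr.
exists #|H| => //; exists H; split=> //.
  apply: linear_forest_spanning.
    move=> v a b c va vb vc ab ac bc.
    apply: (two_hubs_degree xh (Hx v) (Hh v) (Hx a) (Hh a) (Hx b) (Hh b)
              (Hx c) (Hh c)) => //; by rewrite (inj_eq val_inj).
  move=> v p vp U p2 pv.
  apply: (@two_hubs_acyclic x h (val v) (map val p)) => //.
  - by move=> u; rewrite -map_cons => /mapP[w _ ->].
  - by rewrite (map_path (b := xpred0) (e' := @adj H)) ?has_pred0 //.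
  - by rewrite -map_cons map_inj_uniq //; apply: val_inj.
  - by rewrite size_map.
  - by rewrite last_map.
apply: (@isomorphic_of G (join H (complete 2)) (fun k => match k with
  | inl v => val (v : H) | inr i => if (i : 'I_2) == ord0 then x else h end)).
- move=> [u|i] [v|j] /=.
  + by move/val_inj->.
  + by case: ifP => _ E; have := valP u; rewrite /= E eqxx ?andbF.
  + by case: ifP => _ E; have := valP v; rewrite /= -E eqxx ?andbF.
  + move: i j => [[|[|i]] //= iP] [[|[|j]] //= jP] E; congr inr; apply/val_inj => //=.
    * by rewrite E adj_irr in xh.
    * by rewrite E adj_irr in xh.
- move=> v; case: (eqVneq v x) => [->|vx]; first by exists (inr ord0).
  case: (eqVneq v h) => [->|vh]; first by exists (inr (Ordinal (isT : 1 < 2))).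
  by exists (inl (Sub v (introT andP (conj vx vh)) : H)).
- move=> [u|i] [v|j] //=.
  + by case: ifP => _; rewrite adj_sym ?Hx ?Hh.
  + by case: ifP => _; rewrite ?Hx ?Hh.
  + by move: i j => [[|[|i]] //= iP] [[|[|j]] //= jP]; rewrite ?adj_irr // adj_sym.
Qed.

Lemma card_nbrs_ge v s : uniq s -> all (adj v) s -> size s <= #|nbrs v|.
Proof.
move=> /card_uniqP <- /allP vs; apply: subset_leq_card.
by apply/fintype.subsetP => u /vs; rewrite in_nbrs.
Qed.

Lemma card_nbrs_le v s : (forall u, adj v u -> u \in s) -> #|nbrs v| <= size s.
Proof.
move=> vs; apply: leq_trans (card_size s); apply: subset_leq_card.
by apply/fintype.subsetP => u; rewrite in_nbrs => /vs.
Qed.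

Lemma hub_no_far_vertex x h y : adj x h ->
  (forall v, adj x v -> v != h -> adj h v) ->
  (forall v, #|nbrs v| <= #|nbrs x|) -> y != x -> ~~ adj x y -> False.
Proof.
move=> xh hub max_x yx nxy.
(* The hub [h] is already adjacent to [x] and to all of N(x) but itself, which exhausts the maximum
   degree. *)
have nhy v : v != x -> ~~ adj x v -> ~~ adj h v.
  move=> vx nxv; apply/negP => hv; have := max_x h; apply/negP; rewrite -ltnNge.
  have hN : h \notin nbrs x :\ h by rewrite !inE eqxx.
  rewrite (cardsD1 h (nbrs x)) in_nbrs xh add1n.
  apply: (@leq_trans #|x |: (v |: (nbrs x :\ h))|).
    rewrite cardsU1 !inE cardsU1 !inE /= !andbT adj_irr.
    by rewrite (negPf nxv) !andbF orbF eq_sym vx.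
  apply: subset_leq_card; apply/fintype.subsetP => u; rewrite in_nbrs !inE /= !andbT.
  case/or3P => [/eqP->|/eqP->//|/andP[uh xu]]; first by rewrite adj_sym.
  exact: hub.
have nhy1 := nhy y yx nxy.
have nyh : y != h by solve_neq.
have step f : adj x f -> f != h -> exists f', [/\ adj x f', adj h f', adj f f' & adj y f'].
  move=> xf fh; have [|||v [vx vy vf]] := @triple x y f; try solve_neq.
  have vh : v != h by solve_neq.
  exists v; split; try solve_adj; apply: hub => //; solve_adj.
have [|||f1 [f1x f1y f1h]] := @triple x y h; try solve_neq.
have f1h' : f1 != h by solve_neq.
have xf1 : adj x f1 by solve_adj.
have [f2 [xf2 hf2 f12 yf2]] := step f1 xf1 f1h'.
have only f : adj x f -> adj y f -> f = f1 \/ f = f2.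
  move=> xf yf; case: (eqVneq f f1) => ff1; first by left.
  case: (eqVneq f f2) => ff2; [by right|exfalso].
  have fh : f != h by solve_neq.
  have hf := hub f xf fh.
  apply: (@K33 x h y f [::] f1 [::] f2 [::]); solve_minor.
have [|||y2 [y2y y2f1 y2f2]] := @triple y f1 f2; try solve_neq.
have nxy2 : ~~ adj x y2.
  apply/negP => xy2; have [||E|E] := only y2; try solve_adj; subst y2; adj_absurd.
have y2x : y2 != x by solve_neq.
have nhy2 := nhy y2 y2x nxy2.
(* The degree of [f1] exceeds that of [x]. *)
have rest f : adj x f -> f != h -> f != f1 -> f != f2 -> adj f f1 \/ adj f f2.
  move=> xf fh ff1 ff2; have [f' [xf' _ ff' yf']] := step f xf fh.
  by case: (only f' xf' yf') => <-; [left|right].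
(* By K_{3,3} on the side of [x], [h], [g], a vertex of N(x) other than [h] has at most two
   neighbours in N(x) besides [h]. Since [f1] and [f2] are adjacent, each has at most one more. *)
have uniq_nbr g f f' : adj x g -> adj x f -> adj x f' -> g != h -> f != h -> f' != h ->
    forall e, adj x e -> e != h -> adj g e -> adj g f -> adj g f' -> f != e ->
    f' != e -> f = f'.
  move=> xg xf xf' gh fh f'h e xe eh ge gf gf' fe f'e.
  case: (eqVneq f f') => // ff'; exfalso.
  have hf := hub f xf fh; have hf' := hub f' xf' f'h; have he := hub e xe eh.
  have hg := hub g xg gh.
  apply: (@K33 x h g f [::] f' [::] e [::]); solve_minor.
(* If [f2] has no further neighbour, [h] is a harmless placeholder: [g'] only lengthens a list that
   contains N(x). *)
have [g' g'P] : exists g', forall f, adj x f -> f != h -> f != f1 -> f != f2 ->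
    adj f f2 -> f = g'.
  case: (pselect (exists f, [/\ adj x f, f != h, f != f1, f != f2 & adj f f2]));
    last by move=> N; exists h => f *; exfalso; apply: N; exists f.
  move=> [g [xg gh gf1 gf2 gf]]; exists g => f xf fh ff1 ff2 ff.
  by apply: (@uniq_nbr f2 f g _ _ _ _ _ _ f1); try solve_adj; solve_neq.
case: (pselect (exists f, [/\ adj x f, f != h, f != f1, f != f2 & adj f f1])).
  move=> [g [xg gh gf1 gf2 gf]]; have := max_x f1; apply/negP; rewrite -ltnNge.
  have gy : g != y by solve_neq.
  (* N(x) lies in [h], [f1], [f2], [g], [g'], whereas [f1] has the six neighbours [f2], [x], [h],
     [y], [y2], [g]. Without [g] the comparison is 4 against 5. *)
  apply: (@leq_trans 6); last first.
    apply: (@card_nbrs_ge f1 [:: f2; x; h; y; y2; g]); first solve_uniq.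
    by rewrite /= !andbT; repeat (apply/andP; split); solve_adj.
  apply: (@card_nbrs_le x [:: h; f1; f2; g; g']) => u xu; rewrite !inE.
  case: eqVneq => //= uh; case: eqVneq => //= uf1; case: eqVneq => //= uf2.
  case: (rest u xu uh uf1 uf2) => uf; last by rewrite (g'P u) // eqxx orbT.
  apply/orP; left; apply/eqP.
  by apply: (@uniq_nbr f1 u g _ _ _ _ _ _ f2); try solve_adj; solve_neq.
move=> N; have := max_x f1; apply/negP; rewrite -ltnNge.
apply: (@leq_trans 5); last first.
  apply: (@card_nbrs_ge f1 [:: f2; x; h; y; y2]); first solve_uniq.
  by rewrite /= !andbT; repeat (apply/andP; split); solve_adj.
apply: (@card_nbrs_le x [:: h; f1; f2; g']) => u xu; rewrite !inE.
case: eqVneq => //= uh; case: eqVneq => //= uf1; case: eqVneq => //= uf2.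
case: (rest u xu uh uf1 uf2) => uf; first by exfalso; apply: N; exists u.
by rewrite (g'P u) // eqxx.
Qed.

Lemma triple_exceptional : 3 <= #|G| ->
  [\/ exists2 m, 2 <= m & class_T m G, isomorphic G S5 | isomorphic G S7].
Proof.
move=> /card_gt2P[v0 [v1 [v2 [_ [v01 v12 v20]]]]].
case: (@arg_maxnP G v0 predT (fun v => #|nbrs v|) isT) => x _ max_x.
have {}max_x v : #|nbrs v| <= #|nbrs x| by apply: max_x.
have link := triple_link triple (x := x).
case: (pselect (forall h, adj x h -> exists u, [/\ adj x u, u != h & ~~ adj h u])).
  move=> no_hub; have nx : exists h, adj x h.
    have [z [w [xz xw zw]]] : exists z w, [/\ x != z, x != w & z != w].
      case: (eqVneq x v0) => [->|xv0]; first by exists v1, v2; rewrite eq_sym in v20.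
      case: (eqVneq x v1) => [->|xv1]; last by exists v0, v1.
      by exists v0, v2; rewrite eq_sym; rewrite eq_sym in v20.
    by have [v [vx _ _]] := triple xz xw zw; exists v; rewrite adj_sym.
  have [b [c [d [tb [tc [td S]]]]]] := link_sun planarG link no_hub nx.
  by case: (sun_isomorphic planarG triple S); [constructor 2|constructor 3].
move=> /existsNP[h /not_implyP[xh Nh]]; constructor 1.
have hub v : adj x v -> v != h -> adj h v.
  by move=> xv vh; apply/negPn/negP => nhv; apply: Nh; exists v.
apply: (two_hubs_class_T xh).
  move=> v vx vh; have xv : adj x v.
    by apply/negPn/negP => nxv; apply: (hub_no_far_vertex xh hub max_x vx nxv).
  by split=> //; apply: hub.
case: (pselect (exists v, v != x /\ v != h)) => // N; exfalso.
have two v : v = x \/ v = h.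
  case: (eqVneq v x) => vx; first by left.
  by case: (eqVneq v h) => vh; [right|exfalso; apply: N; exists v].
case: (two v0) (two v1) (two v2) v01 v12 v20 => -> [] -> [] ->; by rewrite eqxx.
Qed.
End Hub.

(** * The sets A_n *)

Section AFacts.
Variable G : sgraph.
Implicit Types (v w x : G) (s : seq G).

Lemma A_seqP n a : A n G a <->
  exists s, [/\ uniq s, size s = n & #|common_nbrs s| = a].
Proof.
split=> [[u Uu ua]|[s [Us sn sa]]]; first by exists u; rewrite size_tuple.
by subst n; exists (in_tuple s).
Qed.

Lemma common_nbrs_sub s s' : {subset s' <= s} ->
  common_nbrs s \subset common_nbrs s'.
Proof.
move=> ss'; apply/fintype.subsetP => v; rewrite !in_common_nbrs => /allP H.
by apply/allP => u /ss'/H.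
Qed.

Lemma extend_uniq s n : uniq s -> size s <= n <= #|G| ->
  exists s', [/\ uniq s', size s' = n & {subset s <= s'}].
Proof.
move=> Us /andP[sn nG]; pose r := [seq v <- enum G | v \notin s].
have rE : size s + size r = #|G|.
  have -> : size r = #|[predC s]|.
    rewrite cardE; apply/perm_size/uniq_perm.
    - exact/filter_uniq/enum_uniq.
    - exact: enum_uniq.
    by move=> v; rewrite mem_filter !mem_enum !inE andbT.
  by rewrite -(card_uniqP Us) cardC.
exists (s ++ take (n - size s) r); split.
- rewrite cat_uniq Us take_uniq ?andbT; last exact/filter_uniq/enum_uniq.
  by apply/hasPn => v /mem_take; rewrite mem_filter => /andP[].
- by rewrite size_cat size_takel ?subnKC // leq_subLR rE.
- by move=> v vs; rewrite mem_cat vs.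
Qed.

Lemma A_card n a : 0 < n -> A n G a -> n + a <= #|G|.
Proof.
move=> n0 /A_seqP[s [Us sn <-]]; rewrite -sn -(card_uniqP Us).
have D : #|[predI s & common_nbrs s]| = 0.
  apply: eq_card0 => v; apply/negbTE/negP => /andP[/= vs].
  by rewrite in_common_nbrs => /allP/(_ v vs); rewrite adj_irr.
by rewrite -cardUI D addn0 max_card.
Qed.

Lemma A_empty n : #|G| < n -> A n G = set0.
Proof.
move=> Gn; apply/seteqP; split=> // a /A_seqP[s [Us sn _]].
by move: Gn; rewrite -sn -(card_uniqP Us) ltnNge max_card.
Qed.

Lemma A_degree n a : A n G a.+1 -> n <= max_degree G.
Proof.
move=> /A_seqP[s [Us sn sa]].
have /card_gt0P[v] : 0 < #|common_nbrs s| by rewrite sa.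
rewrite in_common_nbrs => /allP sv.
apply: leq_trans (leq_bigmax v); rewrite -sn; apply: card_nbrs_ge => //.
by apply/allP => u /sv; rewrite adj_sym.
Qed.

Lemma max_degree_lt n : 0 < n -> n <= max_degree G -> n < #|G|.
Proof.
move=> n0 nD; have /card_gt0P[v0 _] : 0 < #|G|.
  rewrite lt0n; apply: contraL n0 => /eqP G0; rewrite -leqNgt.
  apply: leq_trans nD _; apply/bigmax_leqP => v _.
  by case: (fintype0 v G0).
have [v Dv] : exists v, max_degree G = #|nbrs v|.
  have [|v E] := @eq_bigmax G (fun v => #|nbrs v|); first by apply/card_gt0P; exists v0.
  by exists v.
rewrite Dv in nD; apply: leq_ltn_trans nD _.
apply: leq_trans (max_card (mem (v |: nbrs v))).
by rewrite cardsU1 in_nbrs adj_irr.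
Qed.

Lemma A0_extend m n : m <= n <= #|G| -> A m G 0 -> A n G 0.
Proof.
move=> mn /A_seqP[s [Us sm s0]]; rewrite -sm in mn.
have [s' [Us' s'n ss']] := extend_uniq Us mn; apply/A_seqP; exists s'; split=> //.
apply/eqP; rewrite -leqn0 -s0; apply: subset_leq_card; exact: common_nbrs_sub.
Qed.

Lemma A1_other n v s : ~ A n G 1 -> uniq s -> size s = n ->
  all (fun u => adj u v) s -> exists2 w, w != v & all (fun u => adj u w) s.
Proof.
move=> NA Us sn sv; apply: contrapT => N; apply: NA; apply/A_seqP; exists s; split=> //.
apply/eqP/cards1P; exists v; apply/setP => w; rewrite in_common_nbrs !inE.
case: eqVneq => [->|wv]; first exact: sv.
by apply/negbTE/negP => sw; apply: N; exists w.
Qed.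
End AFacts.

Lemma set012E a : [set 0; 1; 2] a <-> a <= 2.
Proof.
split=> [[[->|->]|->] //|]; case: a => [|[|[|a]]] // _.
- by left; left.
- by left; right.
- by right.
Qed.

Lemma set01E a : [set 0; 1] a <-> a <= 1.
Proof.
split=> [[->|->] //|]; case: a => [|[|a]] // _.
- by left.
- by right.
Qed.

(** * The sets A_n of planar graphs *)

Section PlanarA.
Variables (R : realType) (G : sgraph) (planarG : planar R G).

Lemma A_le2 n a : 3 <= n -> A n G a -> a <= 2.
Proof.
move=> n3 /A_seqP[s [Us sn <-]]; rewrite leqNgt; apply/negP.
move=> /card_gt2P[v [w [u [[]]]]]; rewrite !in_common_nbrs => sv sw su [vw wu uv].
apply: (@three_common_nbrs R G planarG v w u s); rewrite ?sn //; by rewrite eq_sym.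
Qed.

Lemma A1_twin n : 3 <= n -> ~ A n G 1 -> twin_from n G.
Proof. by move=> n3 NA; apply: (twin_from_A1 planarG n3) => v s; apply: A1_other. Qed.

Lemma A0_or_exceptional n : 3 <= n <= #|G| -> A n G 0 \/
  [\/ exists2 m, 2 <= m & class_T m G, isomorphic G S5 | isomorphic G S7].
Proof.
move=> /andP[n3 nG]; case: (pselect (A 3 G 0)) => [A3|NA3].
  by left; apply: A0_extend A3; rewrite n3.
right; apply: (triple_exceptional planarG); last exact: leq_trans nG.
move=> y z w yz yw zw; apply: contrapT => N; apply: NA3; apply/A_seqP.
exists [:: y; z; w]; split=> //.
  by rewrite /= !inE negb_or yz yw zw.
apply: eq_card0 => v; rewrite in_common_nbrs /= andbT; apply/negbTE/negP.
move=> /and3P[yv zv wv]; apply: N; exists v; split; by rewrite adj_sym.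
Qed.

Lemma A_ge2 n (s : seq G) (v w : G) : 3 <= n -> uniq s -> size s = n -> v != w ->
  all (fun u => adj u v) s -> all (fun u => adj u w) s -> A n G 2.
Proof.
move=> n3 Us sn vw sv sw; apply/A_seqP; exists s; split=> //.
apply/eqP; rewrite eqn_leq (@A_le2 n) //; last by apply/A_seqP; exists s.
by apply/card_gt1P; exists v, w; rewrite !in_common_nbrs.
Qed.

Lemma A2_bipartite n : A n G 2 -> is_subgraph (complete_bipartite 2 n) G.
Proof.
move=> /A_seqP[s [Us sn s2]].
have /card_gt1P[v [w []]] : 1 < #|common_nbrs s| by rewrite s2.
rewrite !in_common_nbrs => /allP sv /allP sw vw.
have s_nth (i : 'I_n) : nth v s i \in s by rewrite mem_nth // sn.
apply/existsP; exists [ffun k : complete_bipartite 2 n => match k with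
  | inl i => if i == ord0 then v else w | inr i => nth v s i end].
apply/andP; split.
  apply/injectiveP => -[i|i] [j|j]; rewrite !ffunE.
  - move: i j => [[|[|i]] //= iP] [[|[|j]] //= jP] E; congr inl; apply/val_inj => //=.
      by rewrite E eqxx in vw.
    by rewrite E eqxx in vw.
  - by move=> E; exfalso; have := s_nth j; rewrite -E; case: ifP => _ h;
      [have := sv _ h|have := sw _ h]; rewrite adj_irr.
  - by move=> E; exfalso; have := s_nth i; rewrite E; case: ifP => _ h;
      [have := sv _ h|have := sw _ h]; rewrite adj_irr.
  - by move/eqP; rewrite nth_uniq ?sn // => /eqP/ord_inj->.
apply/forallP => -[i|i]; apply/forallP => -[j|j]; rewrite ?ffunE //=.
  by case: ifP => _; rewrite adj_sym; [apply: sv|apply: sw].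
by case: ifP => _; [apply: sv|apply: sw].
Qed.

Lemma A2_leq_L n : 3 <= n -> A n G 2 <-> n <= L G.
Proof.
move=> n3; split=> [A2|nL].
  have nG : n < #|G|.
    by have := A_card (leq_trans (isT : 0 < 3) n3) A2; apply: leq_trans; rewrite addn2.
  exact: (@leq_bigmax_cond _ _ _ (Ordinal nG) (A2_bipartite A2)).
(* As [n] is positive, [n <= L G] cannot come from the value 0 of an empty maximum, so some K_{2,l}
   with l >= n occurs. *)
have [l [nl /existsP[f /andP[/injectiveP f_inj /forallP f_adj]]]] :
    exists l, n <= l /\ is_subgraph (complete_bipartite 2 l) G.
  apply: contrapT => N; move: nL; apply/negP; rewrite -ltnNge -(prednK (ltnW (ltnW n3))) ltnS.
  apply/bigmax_leqP => l lP; rewrite -ltnS (prednK (ltnW (ltnW n3))) ltnNge.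
  by apply/negP => nl; apply: N; exists l.
have {}f_adj k k' : adj k k' -> adj (f k) (f k').
  by move=> kk; have /forallP/(_ k') := f_adj k; rewrite kk.
apply: (@A_ge2 n [seq f (inr (widen_ord nl i)) | i <- enum 'I_n] (f (inl ord0))
          (f (inl ord_max))) => //.
- rewrite map_inj_uniq ?enum_uniq // => i j /f_inj[/eqP].
  by rewrite /= => /eqP/ord_inj.
- by rewrite size_map size_enum_ord.
- by rewrite (inj_eq f_inj).
- by apply/allP => _ /mapP[i _ ->]; apply: f_adj.
- by apply/allP => _ /mapP[i _ ->]; apply: f_adj.
Qed.

Lemma A2_twin m n : m <= max_degree G -> twin_from m G -> 3 <= n <= max_degree G ->
  A n G 2.
Proof.
move=> mD tw /andP[n3 nD].
have nG := max_degree_lt (leq_trans (isT : 0 < 3) n3) nD.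
have [|v E] := @eq_bigmax G (fun v => #|nbrs v|); first exact: leq_ltn_trans nG.
rewrite /max_degree E in mD nD; have [w wv Nwv] := tw v mD.
have sN u : u \in take n (enum (nbrs v)) -> adj u v.
  by move/mem_take; rewrite mem_enum in_nbrs adj_sym.
apply: (@A_ge2 n (take n (enum (nbrs v))) v w) => //.
- by rewrite take_uniq ?enum_uniq.
- by rewrite size_takel // -cardE.
- by rewrite eq_sym.
- by apply/allP.
- by apply/allP => u /sN; rewrite !(adj_sym u) -!in_nbrs Nwv.
Qed.

Lemma twin_from_class_Q n : 3 <= n <= max_degree G -> twin_from n G ->
  exists2 m, 3 <= m & class_Q R m G.
Proof.
move=> /andP[n3 nD] tw.
pose P k := `[< 3 <= k /\ twin_from k G >].
have P0 : exists k, P k by exists n; apply/asboolP.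
case: (ex_minnP P0) => m /asboolP[m3 mtw] mmin.
have mn : m <= n by apply: mmin; apply/asboolP.
exists m => //; split=> //; first exact: leq_trans nD.
by move=> k k3 ktw; apply: mmin; apply/asboolP.
Qed.

Lemma non_exceptional_A n : ~ exceptional R G -> 3 <= n ->
  [/\ n <= L G -> A n G = [set 0; 1; 2],
      L G < n <= max_degree G -> A n G = [set 0; 1],
      max_degree G < n <= #|G| -> A n G = [set 0]
    & #|G| < n -> A n G = set0].
Proof.
move=> NE n3; have n0 := leq_trans (isT : 0 < 3) n3.
have A0 : n <= #|G| -> A n G 0.
  move=> nG; have [//|H] := A0_or_exceptional (introT andP (conj n3 nG)).
  by case: NE; case: H => [H|H|H]; [constructor 1|constructor 3|constructor 4].
have A1 : n <= max_degree G -> A n G 1.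
  move=> nD; apply: contrapT => /(A1_twin n3) tw; apply: NE; constructor 2.
  by apply: twin_from_class_Q tw; rewrite n3.
split=> [nL|/andP[Ln nD]|/andP[Dn nG]|]; last exact: A_empty.
- have A2 : A n G 2 by apply/A2_leq_L.
  have nD := A_degree A2.
  apply/seteqP; split=> [a /(A_le2 n3)|a] /set012E //.
  case: a => [|[|[|a]]] // _; last exact: A1.
  exact/A0/ltnW/max_degree_lt.
- apply/seteqP; split=> [a Aa|a /set01E].
    apply/set01E; case: a Aa (A_le2 n3 Aa) => [|[|[|a]]] // Aa _.
    by move: Aa => /(A2_leq_L n3); rewrite leqNgt Ln.
  case: a => [|[|a]] // _; last exact: A1.
  exact/A0/ltnW/max_degree_lt.
apply/seteqP; split=> [[|a] //= /A_degree|a /= ->]; last exact: A0.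
by rewrite leqNgt Dn.
Qed.

End PlanarA.

(** * Evaluation of A_n for K_4, S_5 and S_7 *)

Fixpoint sublists (T : Type) (s : seq T) : seq (seq T) :=
  if s is x :: s' then sublists s' ++ map (cons x) (sublists s') else [:: [::]].

Lemma filter_sublists (T : eqType) (p : pred T) s : [seq x <- s | p x] \in sublists s.
Proof.
elim: s => //= x s IH; rewrite mem_cat; case: (p x); last by rewrite IH.
by rewrite map_f ?orbT.
Qed.

Lemma sublists_uniq (T : eqType) (s s' : seq T) : s' \in sublists s -> uniq s -> uniq s'.
Proof.
move=> H; apply: subseq_uniq; elim: s s' H => [|x s IH] s'.
  by rewrite inE => /eqP->.
rewrite -[sublists _]/(sublists s ++ map (cons x) (sublists s)) mem_cat.
move=> /orP[/IH/subseq_trans|/mapP[r /IH rs ->]].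
  by apply; exact: subseq_cons.
by rewrite /= eqxx.
Qed.

Section Enumerated.
Variables (G : sgraph) (vs : seq G).
Hypotheses (vs_uniq : uniq vs) (vs_all : forall v, v \in vs).

(** The number of common neighbours depends only on the set of chosen vertices, so the sublists of
    one enumeration replace all tuples and the sets A_n become computable. *)
Definition A_list n : seq nat :=
  [seq count (fun v => all (fun u => adj u v) s) vs |
     s <- sublists vs & size s == n].

Lemma card_common_nbrs (s : seq G) :
  #|common_nbrs s| = count (fun v => all (fun u => adj u v) s) vs.
Proof.
rewrite -size_filter -(card_uniqP (filter_uniq _ vs_uniq)).
by apply: eq_card => v; rewrite in_common_nbrs mem_filter vs_all andbT.
Qed.

Lemma A_listP n a : A n G a <-> a \in A_list n.
Proof.
rewrite A_seqP; split=> [[s [Us sn <-]]|/mapP[s]]; last first.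
  rewrite mem_filter => /andP[/eqP sn svs] ->; exists s; split=> //.
    exact: sublists_uniq vs_uniq.
  exact: card_common_nbrs.
have ss : [seq v <- vs | v \in s] =i s by move=> v; rewrite mem_filter vs_all andbT.
apply/mapP; exists ([seq v <- vs | v \in s]).
  rewrite mem_filter filter_sublists andbT -sn; apply/eqP/perm_size/uniq_perm => //.
  exact: filter_uniq.
rewrite card_common_nbrs; apply: eq_count => v; apply: eq_all_r.
by move=> u; rewrite ss.
Qed.

Lemma A_compute n (l : seq nat) :
  all (mem l) (A_list n) && all (mem (A_list n)) l -> A n G = [set a | a \in l].
Proof.
move=> /andP[/allP h1 /allP h2]; apply/seteqP; split=> a /=.
  by move/A_listP/h1.
by move/h2/A_listP.
Qed.

(** Freeness from twins in computable form; it keeps S_5 and S_7 out of every Q_m. *)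
Definition separated : bool :=
  all (fun v => all (fun w => (v == w) || has (fun u => adj v u != adj w u) vs) vs) vs.

Lemma separatedP : separated -> forall v w : G, v != w -> exists u, adj v u != adj w u.
Proof.
move=> /allP sep v w vw; have /allP/(_ w (vs_all w)) := sep v (vs_all v).
by rewrite (negPf vw) => /hasP[u _ ?]; exists u.
Qed.

Lemma card_enumerated : #|G| = size vs.
Proof. by rewrite -(card_uniqP vs_uniq); apply: eq_card => v; rewrite vs_all. Qed.
End Enumerated.

Lemma set1_mem b : [set b] = [set a | a \in [:: b]] :> set nat.
Proof. by apply/seteqP; split=> a /=; rewrite inE => /eqP. Qed.

Lemma set2_mem b c : [set b; c] = [set a | a \in [:: b; c]] :> set nat.
Proof.
apply/seteqP; split=> a /=; rewrite !inE; first by case=> ->; rewrite eqxx ?orbT.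
by case/orP=> /eqP->; [left|right].
Qed.

Lemma set3_mem b c d : [set b; c; d] = [set a | a \in [:: b; c; d]] :> set nat.
Proof.
apply/seteqP; split=> a /=; rewrite !inE.
  by case=> [[]|] ->; rewrite eqxx ?orbT.
by case/or3P=> /eqP->; [left; left|left; right|right].
Qed.

Definition ord4 : seq 'I_4 :=
  [:: Ordinal (isT : 0 < 4); Ordinal (isT : 1 < 4); Ordinal (isT : 2 < 4);
      Ordinal (isT : 3 < 4)].

Lemma ord4_all i : i \in ord4.
Proof. by case: i => [[|[|[|[|i]]]] iP]. Qed.

Definition K4_vertices : seq (complete 4) := ord4.

Definition S5_vertices : seq S5 := map inl ord4 ++
  map inr [:: Ordinal (isT : 0 < 3); Ordinal (isT : 1 < 3); Ordinal (isT : 2 < 3)].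

Definition S7_vertices : seq S7 := map inl ord4 ++ map inr ord4.

Lemma S5_vertices_all v : v \in S5_vertices.
Proof. by case: v => [[[|[|[|[|i]]]] iP]|[[|[|[|i]]] iP]]. Qed.

Lemma S7_vertices_all v : v \in S7_vertices.
Proof. by case: v => [[[|[|[|[|i]]]] iP]|[[|[|[|[|i]]]] iP]]. Qed.

Lemma S5_separated : separated S5_vertices.
Proof. by vm_compute. Qed.

Lemma S7_separated : separated S7_vertices.
Proof. by vm_compute. Qed.

Lemma K4_A : [/\ A 3 (complete 4) = [set 1],
      A 4 (complete 4) = [set 0]
    & forall n, 5 <= n -> A n (complete 4) = set0].
Proof.
have all4 : forall v, v \in K4_vertices by exact: ord4_all.
have C n l := @A_compute (complete 4) K4_vertices isT all4 n l.
split; try by rewrite ?set3_mem ?set2_mem ?set1_mem; apply: C; vm_compute.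
by move=> n n5; apply: A_empty; rewrite card_ord.
Qed.

Lemma S5_A : [/\ A 3 S5 = [set 1; 2],
      A 4 S5 = [set 0; 1; 2],
      A 5 S5 = [set 0; 1] /\ A 6 S5 = [set 0; 1],
      A 7 S5 = [set 0]
    & forall n, 8 <= n -> A n S5 = set0].
Proof.
have C n l := @A_compute S5 S5_vertices isT S5_vertices_all n l.
split; rewrite ?set3_mem ?set2_mem ?set1_mem;
  try by [apply: C; vm_compute|split; apply: C; vm_compute].
move=> n n8; apply: A_empty.
by rewrite (@card_enumerated S5 S5_vertices isT S5_vertices_all).
Qed.

Lemma S7_A : [/\ A 3 S7 = [set 1; 2],
      A 4 S7 = [set 0; 1; 2],
      A 5 S7 = [set 0; 1] /\ A 6 S7 = [set 0; 1],
      A 7 S7 = [set 0] /\ A 8 S7 = [set 0]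
    & forall n, 9 <= n -> A n S7 = set0].
Proof.
have C n l := @A_compute S7 S7_vertices isT S7_vertices_all n l.
split; rewrite ?set3_mem ?set2_mem ?set1_mem;
  try by [apply: C; vm_compute|split; apply: C; vm_compute].
move=> n n9; apply: A_empty.
by rewrite (@card_enumerated S7 S7_vertices isT S7_vertices_all).
Qed.

(** * The classes T_m and Q_m *)

Lemma path_triangle_free m (u v w : path_graph m) :
  adj u v -> adj u w -> adj v w -> False.
Proof.
rewrite /= /path_rel.
by move=> /orP[]/eqP h1 /orP[]/eqP h2 /orP[]/eqP h3; lia.
Qed.

Lemma class_TP m (G : sgraph) : class_T m G -> exists x h : G,
  [/\ adj x h, #|G| = m.+2,
      forall v, v != x -> v != h -> adj x v /\ adj h v,
      forall v, v != x -> v != h -> exists w, [/\ w != x, w != h & adj v w] &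
      forall u v w, [/\ u != x, v != x & w != x] -> [/\ u != h, v != h & w != h] ->
        adj u v -> adj u w -> adj v w -> False].
Proof.
move=> [H [[p [p_bij p_adj]] noiso [f [[g fK gK] f_adj]]]].
pose j : complete 2 := ord_max.
exists (g (inr ord0)), (g (inr j)).
have g_adj k l : adj (g k) (g l) = adj k l by rewrite -f_adj !gK.
have gH v : v != g (inr ord0) -> v != g (inr j) -> exists k, v = g (inl k).
  rewrite -(fK v); case: (f v) => [k|[[|[|i]] // iP]] n1 n2; first by exists k.
    by case/eqP: n1; congr (g (inr _)); apply/val_inj.
  by case/eqP: n2; congr (g (inr _)); apply/val_inj.
have g_neq k i : g (inl k) != g (inr i).
  by apply/eqP => /(can_inj gK).
split.
- by rewrite g_adj.
- rewrite (bij_eq_card (Bijective fK gK)) card_sum card_ord.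
  by rewrite (bij_eq_card p_bij) card_ord addn2.
- by move=> v v1 v2; have [k ->] := gH v v1 v2; rewrite !g_adj.
- move=> v v1 v2; have [k ->] := gH v v1 v2; have [l kl] := noiso k.
  by exists (g (inl l)); rewrite !g_neq g_adj.
move=> u v w [u1 v1 w1] [u2 v2 w2].
have [k ->] := gH u u1 u2; have [l ->] := gH v v1 v2; have [i ->] := gH w w1 w2.
rewrite !g_adj /= => kl ki li.
exact: (path_triangle_free (p_adj _ _ kl) (p_adj _ _ ki) (p_adj _ _ li)).
Qed.

(** A twin of the universal vertex [x] is adjacent to [x], hence would be adjacent to itself. This
    separates T_m from Q_m and puts 1 into A_n for members of T_m. *)
Lemma universal_no_twin (G : sgraph) (x : G) k :
  (forall v, v != x -> adj x v) -> k < #|G| -> ~ twin_from k G.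
Proof.
move=> xU kG tw; have Nx : nbrs x = [set~ x]%SET.
  apply/setP => v; rewrite in_nbrs !inE; apply/idP/idP => [xv|]; last exact: xU.
  by apply: contraTneq xv => ->; rewrite adj_irr.
have [|w wx Nw] := tw x; first by rewrite Nx cardsC1 -ltnS (ltn_predK kG).
by have := xU w wx; rewrite -in_nbrs -Nw in_nbrs adj_irr.
Qed.

Lemma twin_from_isomorphic (G S : sgraph) k : isomorphic G S ->
  (forall v w : S, v != w -> exists u, adj v u != adj w u) ->
  k <= max_degree G -> 0 < k -> ~ twin_from k G.
Proof.
move=> [f [[g fK gK] f_adj]] sep kD k0 tw.
have [|v E] := @eq_bigmax G (fun v => #|nbrs v|).
  exact: leq_ltn_trans (max_degree_lt k0 kD).
rewrite /max_degree E in kD; have [w wv Nwv] := tw v kD.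
have [|u /eqP[]] := sep (f w) (f v); first by rewrite (inj_eq (can_inj fK)).
by rewrite -(gK u) !f_adj -!in_nbrs Nwv.
Qed.

Section Cases.
Variables (R : realType) (G : sgraph) (planarG : planar R G).

(** The hubs [x] and [h] are common neighbours of any other vertices, which gives 2. Both hubs with
    an edge of the linear forest have no common neighbour, as the forest has no triangle, which
    gives 0 from n = 4 on. For the last two sizes, n + a <= m + 2 bounds the values. *)
Lemma class_T_A m : 3 <= m -> class_T m G ->
  [/\ A 3 G = [set 1; 2],
      forall n, 4 <= n <= m -> A n G = [set 0; 1; 2],
      A m.+1 G = [set 0; 1],
      A m.+2 G = [set 0]
    & forall n, m.+2 < n -> A n G = set0].
Proof.
move=> m3 /class_TP[x [h [xh Gm hubs noiso tri]]].
have xU v : v != x -> adj x v.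
  by case: (eqVneq v h) => [->//|vh] vx; case: (hubs v vx vh).
have hx : h != x by apply: contraTneq xh => ->; rewrite adj_irr.
have A1 n : 3 <= n <= m.+1 -> A n G 1.
  move=> /andP[n3 nm]; apply: contrapT => /(A1_twin planarG n3).
  by apply: (universal_no_twin xU); rewrite Gm ltnS.
pose s := [seq v <- enum G | (v != x) && (v != h)].
have s_size : size s = m.
  have U : uniq [:: x, h & s].
    by rewrite /= !inE !mem_filter !eqxx /= andbF orbF eq_sym hx; apply/filter_uniq/enum_uniq.
  have : size [:: x, h & s] = #|G|.
    rewrite -(card_uniqP U); apply: eq_card => v; rewrite !inE mem_filter mem_enum andbT.
    by case: (v == x); case: (v == h).
  by rewrite Gm => -[].
have A2 n : 3 <= n <= m -> A n G 2.
  move=> /andP[n3 nm].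
  have sN u : u \in take n s -> adj x u /\ adj h u.
    by move/mem_take; rewrite mem_filter => /andP[/andP[ux uh] _]; apply: hubs.
  apply: (@A_ge2 _ _ planarG n (take n s) x h) => //.
  - exact/take_uniq/filter_uniq/enum_uniq.
  - by rewrite size_takel // s_size.
  - by rewrite eq_sym.
  - by apply/allP => u /sN[xu _]; rewrite adj_sym.
  - by apply/allP => u /sN[_ hu]; rewrite adj_sym.
have A0 n : 4 <= n <= m.+2 -> A n G 0.
  move=> nm; have [f1 f1s] : exists f1, f1 \in s.
    by case: (s) s_size => [m0|f1 ? _]; [rewrite -m0 in m3|exists f1; rewrite mem_head].
  move: f1s; rewrite mem_filter => /andP[/andP[f1x f1h] _].
  have [f2 [f2x f2h f12]] := noiso f1 f1x f1h.
  apply: (@A0_extend G 4); first by rewrite Gm.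
  have f12' : f1 != f2 by apply: contraTneq f12 => ->; rewrite adj_irr.
  apply/A_seqP; exists [:: x; h; f1; f2]; split=> //; first solve_uniq.
  apply: eq_card0 => v; rewrite in_common_nbrs /= andbT; apply/negbTE/negP.
  move=> /and4P[xv hv f1v f2v]; apply: (tri f1 f2 v) => //.
    by split=> //; apply: contraTneq xv => ->; rewrite adj_irr.
  by split=> //; apply: contraTneq hv => ->; rewrite adj_irr.
(* A triple missing a hub has that hub as common neighbour; a triple containing both has a forest
   neighbour of its third vertex. *)
have A3_0 : ~ A 3 G 0.
  move=> /A_seqP[s' [Us' s'3 s'0]]; suff [v vs] : exists v, all (fun u => adj u v) s'.
    have : v \in common_nbrs s' by rewrite in_common_nbrs.
    by rewrite (card0_eq s'0).
  case: (boolP (x \in s')) => [xs|xs]; last first.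
    exists x; apply/allP => u us; rewrite adj_sym xU //.
    by apply: contraTneq us => ->.
  case: (boolP (h \in s')) => [hs|hs]; last first.
    exists h; apply/allP => u us; case: (eqVneq u x) => [->//|ux].
    have uh : u != h by apply: contraTneq us => ->.
    by rewrite adj_sym; case: (hubs u ux uh).
  have [t [ts tx th]] : exists t, [/\ t \in s', t != x & t != h].
    apply: contrapT => N; have : size s' <= size [:: x; h].
      apply: uniq_leq_size => // u us; rewrite !inE.
      case: eqVneq => //= ux; case: eqVneq => //= uh.
      by exfalso; apply: N; exists u.
    by rewrite s'3.
  have [w [wx wh tw]] := noiso t tx th; exists w; apply/allP => u us.
  have [xw hw] := hubs w wx wh.
  case: (eqVneq u x) => [->//|ux]; case: (eqVneq u h) => [->//|uh].
  case: (eqVneq u t) => [->//|ut]; exfalso.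
  have : size [:: x; h; t; u] <= size s'.
    apply: uniq_leq_size; last by move=> v; rewrite !inE => /or4P[]/eqP->.
    solve_uniq.
  by rewrite s'3.
split.
- apply/seteqP; split=> [a Aa|a /= [] ->].
  + case: a Aa (A_le2 planarG (isT : 3 <= 3) Aa) => [|[|[|a]]] // Aa _; [by left|by right].
  + by apply: A1; rewrite /= ltnW.
  + by apply: A2; rewrite /= m3.
- move=> n /andP[n4 nm]; have n3 := ltnW n4.
  apply/seteqP; split=> [a /(A_le2 planarG n3)|a] /set012E //.
  case: a => [|[|[|a]]] // _.
  + by apply: A0; rewrite n4 (leq_trans nm) // ltnW.
  + by apply: A1; rewrite n3 leqW.
  + by apply: A2; rewrite n3.
- apply/seteqP; split=> [a Aa|a] /=; last first.
    move=> /set01E; case: a => [|[|a]] // _; first by apply: A0; rewrite ltnS m3 leqnSn.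
    by apply: A1; rewrite leqnn ltnW.
  by apply/set01E; have := A_card (isT : 0 < m.+1) Aa; rewrite Gm -(addn1 m.+1) leq_add2l.
- apply/seteqP; split=> [a Aa|a /= ->] /=; last by apply: A0; rewrite leqnn andbT !ltnS ltnW.
  by have := A_card (isT : 0 < m.+2) Aa; rewrite Gm -[X in _ <= X]addn0 leq_add2l leqn0 => /eqP.
by move=> n mn; apply: A_empty; rewrite Gm.
Qed.

(** Below m, minimality of m and [A1_twin] put 1 into A_n. From m on, a twin of a single common
    neighbour would be a second one, so 1 is absent. Membership of 0 follows because twins rule out
    T_m, S_5 and S_7. *)
Lemma class_Q_A m : 3 <= m -> class_Q R m G ->
  [/\ forall n, 3 <= n <= m.-1 -> A n G = [set 0; 1; 2],
      forall n, m <= n <= max_degree G -> A n G = [set 0; 2],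
      forall n, max_degree G < n <= #|G| -> A n G = [set 0]
    & forall n, #|G| < n -> A n G = set0].
Proof.
move=> m3 [_ mD _ tw m_min]; have m0 : 0 < m by apply: leq_trans m3.
have mG := max_degree_lt m0 mD.
have A0 n : 3 <= n <= #|G| -> A n G 0.
  move=> nG; case: (A0_or_exceptional planarG nG) => // -[[k _ /class_TP]|iso|iso].
  - move=> [x [h [xh _ hubs _ _]]]; exfalso; apply: (universal_no_twin (x := x) _ mG) => //.
    by move=> v; case: (eqVneq v h) => [->//|vh] vx; case: (hubs v vx vh).
  - exfalso; apply: (twin_from_isomorphic iso _ mD) => //.
    exact: separatedP S5_vertices_all S5_separated.
  - exfalso; apply: (twin_from_isomorphic iso _ mD) => //.
    exact: separatedP S7_vertices_all S7_separated.
split=> [n /andP[n3 nm]|n /andP[mn nD]|n /andP[Dn nG]|n]; last exact: A_empty.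
- have nm' : n < m by rewrite -(prednK m0) ltnS.
  have nD : n <= max_degree G by apply: leq_trans mD; apply: ltnW.
  apply/seteqP; split=> [a /(A_le2 planarG n3)|a] /set012E //.
  case: a => [|[|[|a]]] // _.
  + by apply: A0; rewrite n3 ltnW // max_degree_lt // (leq_trans _ n3).
  + apply: contrapT => /(A1_twin planarG n3) /(m_min n n3).
    by rewrite leqNgt nm'.
  + by apply: (A2_twin planarG mD tw); rewrite n3.
- have n3 : 3 <= n by apply: leq_trans mn.
  apply/seteqP; split=> [a Aa|a /= [] ->].
  + case: a Aa (A_le2 planarG n3 Aa) => [|[|[|a]]] // Aa _; [by left| |by right].
    move: Aa => /A_seqP[s [Us sn /eqP/cards1P[v sv]]]; exfalso.
    have /allP vs : all (fun u => adj u v) s by rewrite -in_common_nbrs sv inE.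
    have [|w wv Nw] := tw v.
      apply: leq_trans mn _; rewrite -sn; apply: card_nbrs_ge => //.
      by apply/allP => u /vs; rewrite adj_sym.
    have : w \in common_nbrs s.
      rewrite in_common_nbrs; apply/allP => u /vs uv.
      by rewrite adj_sym -in_nbrs Nw in_nbrs adj_sym.
    by rewrite sv inE (negPf wv).
  + by apply: A0; rewrite n3 ltnW // max_degree_lt // (leq_trans _ n3).
  + by apply: (A2_twin planarG mD tw); rewrite n3.
have n3 : 3 <= n by rewrite ltnW // (leq_trans _ Dn) // ltnS (leq_trans m3).
apply/seteqP; split=> [[|a] //= /A_degree|a /= ->]; last by apply: A0; rewrite n3.
by rewrite leqNgt Dn.
Qed.

End Cases.

Theorem theorem1p3 (R : realType) (G : sgraph) (planarG : planar R G) :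
  (* (i) *)
  (~ exceptional R G -> forall n, 3 <= n ->
     [/\ n <= L G -> A n G = [set 0; 1; 2],
         L G < n <= max_degree G -> A n G = [set 0; 1],
         max_degree G < n <= #|G| -> A n G = [set 0]
       & #|G| < n -> A n G = set0]) /\
  (* (ii) *)
  (forall m, 3 <= m -> class_T m G ->
     [/\ A 3 G = [set 1; 2],
         forall n, 4 <= n <= m -> A n G = [set 0; 1; 2],
         A m.+1 G = [set 0; 1],
         A m.+2 G = [set 0]
       & forall n, m.+2 < n -> A n G = set0]) /\
  (* (iii) *)
  (forall m, 3 <= m -> class_Q R m G ->
     [/\ forall n, 3 <= n <= m.-1 -> A n G = [set 0; 1; 2],
         forall n, m <= n <= max_degree G -> A n G = [set 0; 2],
         forall n, max_degree G < n <= #|G| -> A n G = [set 0]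
       & forall n, #|G| < n -> A n G = set0]) /\
  (* (iv) *)
  [/\ A 3 (complete 4) = [set 1],
      A 4 (complete 4) = [set 0]
    & forall n, 5 <= n -> A n (complete 4) = set0] /\
  (* (v) *)
  [/\ A 3 S5 = [set 1; 2],
      A 4 S5 = [set 0; 1; 2],
      A 5 S5 = [set 0; 1] /\ A 6 S5 = [set 0; 1],
      A 7 S5 = [set 0]
    & forall n, 8 <= n -> A n S5 = set0] /\
  (* (vi) *)
  [/\ A 3 S7 = [set 1; 2],
      A 4 S7 = [set 0; 1; 2],
      A 5 S7 = [set 0; 1] /\ A 6 S7 = [set 0; 1],
      A 7 S7 = [set 0] /\ A 8 S7 = [set 0]
    & forall n, 9 <= n -> A n S7 = set0].
Proof.
split; first by move=> NE n; exact: (non_exceptional_A planarG NE).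
split; first by move=> m; exact: (class_T_A planarG).
split; first by move=> m; exact: (class_Q_A planarG).
split; first exact: K4_A.
by split; [exact: S5_A|exact: S7_A].
Qed.
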